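(* Let $A$ be a self-adjoint operator on an infinite-dimensional Hilbert space $\mathcal{H}$, let $a<b$ be real numbers with $(a,b)\cap\sigma_{\mathrm{ess}}(A)=\emptyset$ and $a\in\sigma_{\mathrm{ess}}(A)$, let $\kappa\ge0$, and let $B$ be a bounded symmetric operator on $\mathcal{H}$ satisfying $0\le B$ and $\lVert B\rVert<b-a$. Assume that $$\forall x\in\bigcup_{t\in[0,1]}\operatorname{Ran}P_{A+tB}(b):\quad\langle x,Bx\rangle\ge\kappa\lVert x\rVert^2.$$ Then $[a+\kappa,b)\cap\sigma_{\mathrm{ess}}(A+B)\ne\emptyset$.
   Context: $P_A(E)=\mathbf{1}_{(-\infty,E]}(A)$ is the spectral projection of a self-adjoint operator $A$; $\sigma_{\mathrm{ess}}$ denotes the essential spectrum. $A$ need not be semi-bounded. *)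

(* Defs.v *)
From HB Require Import structures.
From mathcomp Require Import all_boot all_order all_algebra.
From mathcomp Require Import sesquilinear complex.
From mathcomp Require Import all_classical all_reals all_analysis.

Set Implicit Arguments.
Unset Strict Implicit.
Unset Printing Implicit Defensive.

Import Order.TTheory GRing.Theory Num.Theory.
Import numFieldNormedType.Exports.

Local Open Scope classical_set_scope.
Local Open Scope ring_scope.
Local Open Scope complex_scope.

(* A complex Hilbert space is a complete normed space [H] over [R[i]] together
   with an inner product [dot], linear in its first argument, such that
   [induces_norm dot] holds.  Norms and inner products take values in [R[i]],
   where [u <= v] means that [u] and [v] have the same imaginary part and
   ordered real parts; in particular [0 <= u] says that [u] is real and
   nonnegative. *)
Definition induces_norm (R : realType) (H : completeNormedModType R[i])
    (dot : {dot H for Num.conj}) : Prop :=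
  forall x, `|x| ^+ 2 = dot x x.

Definition finite_dimensional (R : realType) (H : lmodType R[i])
    (V : set H) : Prop :=
  exists (n : nat) (e : 'I_n -> H),
    forall x, V x -> exists c : 'I_n -> R[i], x = \sum_(i < n) c i *: e i.

(* Possibly unbounded linear operators: [app] is only meaningful on the
   subspace [dom], its values elsewhere are irrelevant. *)
Record operator (R : realType) (H : lmodType R[i]) := Operator {
  dom : set H;
  app :> H -> H;
  dom0 : dom 0;
  domP : forall (c : R[i]) x y, dom x -> dom y -> dom (c *: x + y);
  app_linear : forall (c : R[i]) x y, dom x -> dom y ->
    app (c *: x + y) = c *: app x + app y
}.

Section AddBounded.
Variables (R : realType) (H : lmodType R[i]).
Variables (A : operator H) (B : {linear H -> H}).

Lemma op_add_linear (c : R[i]) x y : dom A x -> dom A y ->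
  A (c *: x + y) + B (c *: x + y) = c *: (A x + B x) + (A y + B y).
Proof.
by move=> Ax Ay; rewrite app_linear// linearP scalerDr addrACA.
Qed.

Definition op_add : operator H :=
  @Operator R H (dom A) (fun x => A x + B x) (dom0 A) (@domP _ _ A)
    op_add_linear.

End AddBounded.

Section Operators.
Variables (R : realType) (H : completeNormedModType R[i]).
Variable (dot : {dot H for Num.conj}).

Definition bounded_operator (B : H -> H) : Prop :=
  exists M : R, forall x, `|B x| <= M%:C * `|x|.

(* Meaningful when [bounded_operator B]. *)
Definition operator_norm (B : H -> H) : R :=
  sup [set complex.Re `|B x| | x in [set x : H | `|x| <= 1]].

Definition symmetric_operator (B : H -> H) : Prop :=
  forall x y, dot (B x) y = dot x (B y).

Definition nonnegative_operator (B : H -> H) : Prop :=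
  forall x, 0 <= dot x (B x).

Definition adjoint_graph (A : operator H) (y z : H) : Prop :=
  forall x, dom A x -> dot (A x) y = dot x z.

Definition self_adjoint (A : operator H) : Prop :=
  dense (dom A) /\
  forall y z, adjoint_graph A y z <-> dom A y /\ A y = z.

Definition resolvent_set (A : operator H) : set R[i] :=
  [set z | exists T : {linear H -> H},
     [/\ bounded_operator T,
         forall y, dom A (T y) /\ A (T y) - z *: T y = y &
         forall x, dom A x -> T (A x - z *: x) = x]].

Definition spectrum (A : operator H) : set R[i] := ~` resolvent_set A.

Definition operator_eigenspace (A : operator H) (z : R[i]) : set H :=
  [set x | dom A x /\ A x = z *: x].

(* Isolated eigenvalues of finite multiplicity; the norm topology is attached
   to the alias [R[i]^o]. *)
Definition discrete_spectrum (A : operator H) : set R[i] :=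
  [set z | [/\ isolated (spectrum A : set R[i]^o) z,
               exists2 x, operator_eigenspace A z x & x != 0 &
               finite_dimensional (operator_eigenspace A z)]].

Definition essential_spectrum (A : operator H) : set R[i] :=
  spectrum A `\` discrete_spectrum A.

Definition orthogonal_projection (P : H -> H) : Prop :=
  [/\ forall (c : R[i]) x y, P (c *: x + y) = c *: P x + P y,
      forall x, P (P x) = P x &
      symmetric_operator P].

(* [P] is the resolution of the identity of [A], that is [A = \int l dP(l)].
   The measure [mu x] is the spectral measure of [A] at [x]: it is given by
   [mu x `]-oo, e] = <P e x, x>].  That it is a measure of total mass [|x|^2]
   encodes that [P] is nondecreasing, strongly right-continuous, and tends
   strongly to [0] at [-oo] and to the identity at [+oo]. *)
Definition resolution_of_identity (A : operator H) (P : R -> H -> H) : Prop :=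
  (forall e, orthogonal_projection (P e)) /\
  exists mu : H -> {measure set R -> \bar R},
    [/\ forall x e, mu x `]-oo, e]%classic = (complex.Re (dot (P e x) x))%:E,
        forall x, mu x setT = (complex.Re (dot x x))%:E,
        dom A = [set x | (\int[mu x]_l (l ^+ 2)%:E < +oo)%E] &
        forall x, dom A x -> dot (A x) x = (\int[mu x]_l l)%R%:C].

(* [spectral_projection A e] is [1_{]-oo, e]}(A)]; the resolution of the
   identity of a self-adjoint operator is unique. *)
Definition spectral_projection (A : operator H) (e : R) : H -> H :=
  get [set P : R -> H -> H | resolution_of_identity A P] e.

End Operators.

(* Main.v *)
(* For small h > 0, let l < b be a point of the essential spectrum of A + tB and
   let V be the (infinite-dimensional) range of the spectral projection of A + tB
   onto a tiny interval around l.  On V the hypothesis gives <x, Bx> >= kappa |x|^2,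
   hence |(A + (t+h)B - m) x| <= (m - l - h kappa + O(h^2)) |x| for a centre m
   slightly above l.  An infinite-dimensional space of such vectors forces a point
   of the essential spectrum of A + (t+h)B within that distance of m, hence at
   least l + h kappa - O(h^2).  Starting from a and taking n steps of length 1/n
   leads from A to A + B with an error O(1/n), and the essential spectrum is
   closed.  The points stay at distance at least b - a - |B| below b since
   0 <= tB <= t|B| keeps (a + t|B|, b) free of essential spectrum.

   As spectral_projection is chosen among the resolutions of the identity, one
   has to be exhibited, which is the spectral theorem: P e is the projection onto
   the kernel of the positive part of (A - e) / (A^2 + 1), the latter being a
   bounded function of the resolvents of A at i and -i, and its modulus a
   square root. *)

Require Import Defs.
From HB Require Import structures.
From mathcomp Require Import all_boot all_order all_algebra.
From mathcomp Require Import sesquilinear complex.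
From mathcomp Require Import all_classical all_reals all_analysis.
From mathcomp Require Import measurable_realfun ring lra.

Set Implicit Arguments.
Unset Strict Implicit.
Unset Printing Implicit Defensive.

Import Order.TTheory GRing.Theory Num.Theory.
Import numFieldNormedType.Exports.

Local Open Scope classical_set_scope.
Local Open Scope ring_scope.
Local Open Scope complex_scope.

(** * The real inner product *)

(** The hypothesis on [B] controls only vectors in ranges of projections of [A + tB] itself, while
    the conclusion of a step concerns [A + (t+h)B]; this forces short steps in which approximate
    eigenvectors of the current operator are tested on the next one. A lower bound on the form of
    [B] does not by itself bound a norm from above. Shifting the centre by a fixed [s] does it: [|h
    B x - s x|^2 = s^2 |x|^2 - 2 s h <x, Bx> + h^2 |Bx|^2], where the gain is of first order in [h]
    and the loss of second order. The choice [s = d / 4] with [d = b - a - |B|] keeps an interval of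
    radius about [s] around [l + s] below [b], because [l <= b - d].

    Essential spectrum is translated once into bands ]c, d] of infinite spectral dimension. Two
    estimates then suffice: [A - m] is small on a narrow band around [m], and large on vectors
    without component in a wide one. Every resolution of the identity is shown to reduce [A] in the
    way these estimates require, so the one selected by choice can be used. *)

Section InnerProduct.
Variables (R : realType) (H : completeNormedModType R[i]).
Variables (dot : {dot H for Num.conj}) (dot_norm : induces_norm dot).

(* Real and imaginary parts of [dot] are recovered from this real inner product
   by [dot_ip], so that estimates can be carried out over [R]. *)
Definition redot (x y : H) : R := complex.Re (dot x y).
Local Notation ip := redot.
Definition nm (x : H) : R := complex.Re `|x|.

Lemma ReD (u v : R[i]) : complex.Re (u + v) = complex.Re u + complex.Re v.
Proof. by case: u => ? ?; case: v. Qed.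

Lemma ReN (u : R[i]) : complex.Re (- u) = - complex.Re u.
Proof. by case: u. Qed.

Lemma ReZ (a : R) (u : R[i]) : complex.Re (a%:C * u) = a * complex.Re u.
Proof. by case: u => ? ? /=; rewrite mul0r subr0. Qed.

Lemma normE (x : H) : `|x| = (nm x)%:C.
Proof. by rewrite /nm RRe_real// ger0_real. Qed.

Lemma nm_ge0 x : 0 <= nm x.
Proof. by rewrite -ler0c -normE normr_ge0. Qed.

Lemma dotxx x : dot x x = (ip x x)%:C.
Proof. by rewrite /redot RRe_real// ger0_real// -dot_norm exprn_ge0. Qed.

Lemma nm2 x : nm x ^+ 2 = ip x x.
Proof.
by apply: (@complexI R); rewrite -dotxx -dot_norm rmorphXn /= normE.
Qed.

Lemma ipC x y : ip x y = ip y x.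
Proof. by rewrite /redot hermC /= expr0 mul1r; case: (dot y x). Qed.

Lemma ipDl x y z : ip (x + y) z = ip x z + ip y z.
Proof. by rewrite /redot linearDl ReD. Qed.

Lemma ipNl x z : ip (- x) z = - ip x z.
Proof. by rewrite /redot linearNl ReN. Qed.

Lemma ipZl (a : R) x z : ip (a%:C *: x) z = a * ip x z.
Proof. by rewrite /redot linearZl_LR ReZ. Qed.

Lemma ipDr x y z : ip x (y + z) = ip x y + ip x z.
Proof. by rewrite ipC ipDl !(ipC _ x). Qed.

Lemma ipNr x z : ip x (- z) = - ip x z.
Proof. by rewrite ipC ipNl ipC. Qed.

Lemma ipZr (a : R) x z : ip x (a%:C *: z) = a * ip x z.
Proof. by rewrite ipC ipZl ipC. Qed.

Lemma ip0l x : ip 0 x = 0.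
Proof. by rewrite -(scale0r 0) (ipZl 0) mul0r. Qed.

Lemma ip0r x : ip x 0 = 0.
Proof. by rewrite ipC ip0l. Qed.

Definition ipE := (ipDl, ipDr, ipNl, ipNr, ipZl, ipZr, ip0l, ip0r).

Lemma ip_ge0 x : 0 <= ip x x.
Proof. by rewrite -nm2 sqr_ge0. Qed.

Lemma nm_eq0 x : nm x = 0 -> x = 0.
Proof. by move=> nx; apply/eqP; rewrite -normr_eq0 normE nx. Qed.

Lemma ip_eq0 x : ip x x <= 0 -> x = 0.
Proof.
move=> le0; apply: nm_eq0; apply/eqP; rewrite -sqrf_eq0 nm2.
by rewrite eq_le le0 ip_ge0.
Qed.

Lemma nm0 : nm 0 = 0.
Proof. by rewrite /nm normr0. Qed.

Lemma nmN x : nm (- x) = nm x.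
Proof. by rewrite /nm normrN. Qed.

Lemma nmB x y : nm (x - y) = nm (y - x).
Proof. by rewrite -nmN opprB. Qed.

Lemma nmD x y : nm (x + y) <= nm x + nm y.
Proof. by rewrite -lecR rmorphD /= -!normE ler_normD. Qed.

Lemma nmZ (a : R) x : nm (a%:C *: x) = `|a| * nm x.
Proof.
apply: (@complexI R); rewrite rmorphM /= -!normE normrZ; congr (_ * _).
by rewrite normc_def /= expr0n /= addr0 sqrtr_sqr.
Qed.

Lemma le_nm (x y : H) : ip x x <= ip y y -> nm x <= nm y.
Proof. by rewrite -!nm2 ler_sqr ?nnegrE ?nm_ge0. Qed.

(* Expand the square norm of [nm x y - nm y x]. *)
Lemma cauchy_schwarz x y : ip x y <= nm x * nm y.
Proof.
have [->|x0] := eqVneq x 0; first by rewrite ip0l nm0 mul0r.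
have [->|y0] := eqVneq y 0; first by rewrite ip0r nm0 mulr0.
have nx : 0 < nm x.
  by rewrite lt_neqAle nm_ge0 andbT eq_sym; apply: contra_neq x0 => /nm_eq0.
have ny : 0 < nm y.
  by rewrite lt_neqAle nm_ge0 andbT eq_sym; apply: contra_neq y0 => /nm_eq0.
have := ip_ge0 ((nm y)%:C *: x - (nm x)%:C *: y).
rewrite !ipE (ipC y x) -!nm2 => h.
have h2 : (nm x * nm y) * ip x y <= (nm x * nm y) * (nm x * nm y) by lra.
by rewrite -(ler_pM2l (mulr_gt0 nx ny)).
Qed.

Lemma cauchy_schwarz_abs x y : `|ip x y| <= nm x * nm y.
Proof.
rewrite ler_norml cauchy_schwarz andbT lerNl -ipNl -(nmN x).
exact: cauchy_schwarz.
Qed.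

(** Multiplication by [i] is kept as a real isometry, so that complex linearity and complex
    orthogonality become real statements about [x] and [J x]. *)
Definition J (x : H) : H := 'i%C *: x.

Lemma scaleE (c : R[i]) x :
  c *: x = (complex.Re c)%:C *: x + (complex.Im c)%:C *: J x.
Proof. by rewrite {1}[c]complexE scalerDl scalerA [_ * 'i%C]mulrC. Qed.

Lemma ipJl x y : ip (J x) y = - ip x (J y).
Proof.
by rewrite /redot /J linearZl_LR linearZr_LR /=; case: (dot x y) => a b /=; ring.
Qed.

Lemma JJ x : J (J x) = - x.
Proof. by rewrite /J scalerA -expr2 sqr_i scaleN1r. Qed.

Lemma ipJJ x y : ip (J x) (J y) = ip x y.
Proof. by rewrite ipJl JJ ipNr opprK. Qed.

Lemma ipxJ x : ip x (J x) = 0.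
Proof. by have := ipJl x x; rewrite ipC => h; lra. Qed.

Lemma nmJ x : nm (J x) = nm x.
Proof. by apply/eqP; rewrite -(@eqrXn2 _ 2) ?nm_ge0// !nm2 ipJJ. Qed.

Lemma dot_ip x y : dot x y = Complex (ip x y) (ip x (J y)).
Proof.
rewrite /redot /J linearZr_LR /=.
by case: (dot x y) => a b /=; congr Complex; ring.
Qed.

Lemma dot_ipP x y z w :
  dot x y = dot z w <-> ip x y = ip z w /\ ip x (J y) = ip z (J w).
Proof. by rewrite !dot_ip; split => [[-> ->]|[-> ->]]. Qed.

Lemma ip_inj x y : (forall z, ip z x = ip z y) -> x = y.
Proof.
move=> h; apply/eqP; rewrite -subr_eq0; apply/eqP/ip_eq0.
by rewrite ipDr ipNr h subrr.
Qed.

(** The norm of [H] takes values in [R[i]]; going through [nm] turns limits into statements on real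
    sequences, where squeezing applies. *)
Definition hlim (u : nat -> H) (l : H) := (fun n => nm (u n - l)) @ \oo --> (0 : R).

End InnerProduct.

(** * Norm limits and completeness in terms of real sequences *)

Section Limits.
Variables (R : realType) (H : completeNormedModType R[i]).
Variables (dot : {dot H for Num.conj}) (dot_norm : induces_norm dot).
Local Notation ip := (redot dot).

Lemma cvg0_le (a b : nat -> R) :
  (forall n, 0 <= a n <= b n) -> b @ \oo --> (0 : R) -> a @ \oo --> (0 : R).
Proof. by move=> ab b0; apply: (squeeze_cvgr _ (cvg_cst 0) b0); apply: nearW. Qed.

Lemma hlim_le (u : nat -> H) l (b : nat -> R) :
  (forall n, nm (u n - l) <= b n) -> b @ \oo --> (0 : R) -> hlim u l.
Proof. by move=> ub; apply: cvg0_le => n; rewrite nm_ge0 ub. Qed.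

Lemma hlim_cst (l : H) : hlim (fun=> l) l.
Proof. by rewrite /hlim subrr nm0; exact: cvg_cst. Qed.

Lemma hlimD (u v : nat -> H) l k :
  hlim u l -> hlim v k -> hlim (fun n => u n + v n) (l + k).
Proof.
move=> ul vk; apply: (@hlim_le _ _ (fun n => nm (u n - l) + nm (v n - k))).
  by move=> n; rewrite opprD addrACA nmD.
by rewrite -[0](addr0 0); exact: cvgD.
Qed.

Lemma hlim_lip (f : H -> H) (M : R) (u : nat -> H) l :
  (forall x y, nm (f x - f y) <= M * nm (x - y)) -> hlim u l ->
  hlim (f \o u) (f l).
Proof.
move=> fM ul; apply: (@hlim_le _ _ (fun n => M * nm (u n - l))) => [n|//].
  exact: fM.
by rewrite -[0](mulr0 M); exact: cvgM (cvg_cst _) ul.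
Qed.

Lemma hlimN (u : nat -> H) l : hlim u l -> hlim (fun n => - u n) (- l).
Proof.
by apply: (@hlim_lip -%R 1) => x y; rewrite mul1r -opprD nmN.
Qed.

Lemma hlimB (u v : nat -> H) l k :
  hlim u l -> hlim v k -> hlim (fun n => u n - v n) (l - k).
Proof. by move=> ul /hlimN; exact: hlimD. Qed.

Lemma hlimZ (a : R) (u : nat -> H) l :
  hlim u l -> hlim (fun n => a%:C *: u n) (a%:C *: l).
Proof.
apply: (@hlim_lip (fun x => a%:C *: x) `|a|) => x y.
by rewrite -scalerBr nmZ.
Qed.

Lemma hlimJ (u : nat -> H) l : hlim u l -> hlim (fun n => J (u n)) (J l).
Proof.
apply: (@hlim_lip (fun x => J x) 1) => x y.
by rewrite /J -scalerBr -/(J _) (nmJ dot_norm) mul1r.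
Qed.

Lemma hlim_ip (u : nat -> H) l y :
  hlim u l -> (fun n => ip (u n) y) @ \oo --> ip l y.
Proof.
move=> ul; apply/cvgrPdist_le => /= e e0.
have : (fun n => nm (u n - l) * nm y) @ \oo --> (0 : R).
  by rewrite -[0](mul0r (nm y)); exact: cvgM ul (cvg_cst _).
move/cvgrPdist_le => /(_ _ e0); apply: filterS => n /=.
rewrite sub0r normrN ger0_norm ?mulr_ge0 ?nm_ge0// => h.
apply: le_trans h.
by rewrite distrC -ipNl -ipDl; exact: cauchy_schwarz_abs.
Qed.

Lemma hlim_nm (u : nat -> H) l : hlim u l -> (fun n => nm (u n)) @ \oo --> nm l.
Proof.
move=> ul; apply/cvgrPdist_le => /= e e0.
move/cvgrPdist_le : ul => /(_ _ e0); apply: filterS => n /=.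
rewrite sub0r normrN ger0_norm ?nm_ge0// => h; apply: le_trans h.
have h1 := nmD (u n - l) l; have h2 := nmD (l - u n) (u n).
move: h1 h2; rewrite !subrK (nmB l) => h1 h2.
by rewrite ler_distl; apply/andP; split; lra.
Qed.

Lemma hlim_sq (u : nat -> H) l :
  hlim u l -> (fun n => ip (u n) (u n)) @ \oo --> ip l l.
Proof.
move=> /hlim_nm ul; rewrite -nm2//.
under eq_fun do rewrite -nm2//.
by rewrite expr2; under eq_fun do rewrite expr2; exact: cvgM.
Qed.

Lemma hlim_unique (u : nat -> H) l k : hlim u l -> hlim u k -> l = k.
Proof.
move=> ul uk; apply/eqP; rewrite -subr_eq0; apply/eqP/nm_eq0.
have := hlimB ul uk; move/hlim_nm; under eq_fun do rewrite subrr nm0.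
by move=> h; apply/esym; exact: (cvg_unique _ (cvg_cst 0) h).
Qed.

Lemma hcauchy (u : nat -> H) :
  (forall e : R, 0 < e ->
    exists N, forall m n, (N <= m)%N -> (N <= n)%N -> nm (u m - u n) < e) ->
  exists l, hlim u l.
Proof.
move=> hu.
have /cauchy_cvg uc : cauchy (u @ \oo).
  apply: cauchy_exP => e e0.
  have e1 : 0 < complex.Re e.
    by move: e0; case: (e) => a b; rewrite ltcE /= => /andP[].
  have [N hN] := hu _ e1; exists (u N); exists N => // n /= Nn.
  rewrite -ball_normE /= normE.
  by have := hN _ _ (leqnn N) Nn; rewrite -ltcR (RRe_real (gtr0_real e0)).
exists (lim (u @ \oo)).
apply/cvgrPdist_lt => e e0.
have e1 : 0 < e%:C :> R[i] by rewrite ltcR.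
move/cvgrPdist_lt : uc => /(_ _ e1); apply: filterS => n.
rewrite normE ltcR sub0r normrN ger0_norm ?nm_ge0//.
by rewrite nmB.
Qed.

(** A bounded monotone real sequence is Cauchy. It serves for monotone sequences of operators and
    for the truncations of [A x]. *)
Lemma monotone_cauchy (u : nat -> H) (a : nat -> R) (K : R) :
  nondecreasing_seq a -> (forall n, a n <= K) ->
  (forall m n, (m <= n)%N -> nm (u n - u m) ^+ 2 <= 2 * (a n - a m)) ->
  exists l, hlim u l.
Proof.
move=> ndA aK ua; apply: hcauchy => e e0.
have ac : cvgn a by apply: nondecreasing_is_cvgn => //; exists K => _ [n _ <-].
have e2 : 0 < e ^+ 2 / 2 by rewrite divr_gt0// exprn_gt0.
have [N _ hN] := (cvgrPdist_lt _ _).1 ac _ e2.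
have main m n : (N <= m)%N -> (m <= n)%N -> nm (u n - u m) < e.
  move=> Nm mn; rewrite -(@ltr_pXn2r _ 2) ?nnegrE ?nm_ge0 ?ltW//.
  apply: le_lt_trans (ua _ _ mn) _.
  have an : a n <= lim (a @ \oo) by exact: nondecreasing_cvgn_le.
  have := hN m Nm => /= /(le_lt_trans (ler_norm _)).
  by move: an; move: (lim _) => L *; lra.
exists N => m n Nm Nn; have [mn|/ltnW mn] := leqP m n; last exact: main.
by rewrite nmB; exact: main.
Qed.

End Limits.

(** * Linear functions, subspaces and projections *)

Section LinearFunctions.
Variables (R : realType) (H : completeNormedModType R[i]).
Variables (dot : {dot H for Num.conj}) (dot_norm : induces_norm dot).
Local Notation ip := (redot dot).

Definition islin (f : H -> H) :=
  forall (c : R[i]) x y, f (c *: x + y) = c *: f x + f y.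

Section Theory.
Variables (f : H -> H) (lf : islin f).

Lemma islin0 : f 0 = 0.
Proof.
have := lf 1 0 0; rewrite !scale1r add0r => /eqP.
by rewrite -{1}[f 0]addr0 (inj_eq (addrI _)) eq_sym => /eqP.
Qed.

Lemma islinD x y : f (x + y) = f x + f y.
Proof. by rewrite -[x in LHS]scale1r lf scale1r. Qed.

Lemma islinZ c x : f (c *: x) = c *: f x.
Proof. by rewrite -[c *: x]addr0 lf islin0 addr0. Qed.

Lemma islinN x : f (- x) = - f x.
Proof. by rewrite -scaleN1r islinZ scaleN1r. Qed.

Lemma islinB x y : f (x - y) = f x - f y.
Proof. by rewrite islinD islinN. Qed.

Lemma islinJ x : f (J x) = J (f x).
Proof. exact: islinZ. Qed.

End Theory.

Lemma islin_linear (f : {linear H -> H}) : islin f.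
Proof. by move=> c x y; rewrite linearP. Qed.

Lemma islin_comp f g : islin f -> islin g -> islin (f \o g).
Proof. by move=> lf lg c x y /=; rewrite lg lf. Qed.

Lemma islin_add f g : islin f -> islin g -> islin (fun x => f x + g x).
Proof. by move=> lf lg c x y /=; rewrite lg lf scalerDr addrACA. Qed.

Lemma islin_scale (a : R[i]) f : islin f -> islin (fun x => a *: f x).
Proof.
by move=> lf c x y /=; rewrite lf scalerDr !scalerA [a * c]mulrC.
Qed.

Lemma islin_opp f : islin f -> islin (fun x => - f x).
Proof. by move=> lf c x y /=; rewrite lf opprD scalerN. Qed.

Lemma islin_sub f g : islin f -> islin g -> islin (fun x => f x - g x).
Proof. by move=> lf lg; apply: islin_add => //; exact: islin_opp. Qed.

Lemma linear_of (f : H -> H) : islin f -> exists g : {linear H -> H}, g =1 f.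
Proof.
move=> lf.
pose g := HB.pack_for {linear H -> H} f (GRing.isLinear.Build _ _ _ _ f lf).
by exists g.
Qed.

Lemma bounded_operatorP (f : H -> H) :
  bounded_operator f <-> exists2 M : R, 0 < M & forall x, nm (f x) <= M * nm x.
Proof.
split=> [[M fM]|[M _ fM]].
  exists (`|M| + 1) => [|x]; first by rewrite ltr_wpDl.
  have := fM x; rewrite !normE -rmorphM lecR => /le_trans; apply.
  by rewrite ler_wpM2r ?nm_ge0// (le_trans (ler_norm _))// lerDl.
by exists M => x; rewrite !normE -rmorphM lecR.
Qed.

Lemma symmetric_operatorP (f : H -> H) : islin f ->
  symmetric_operator dot f <-> forall x y, ip (f x) y = ip x (f y).
Proof.
move=> lf; split=> [sf x y|sf x y]; first by rewrite /redot sf.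
by apply/dot_ipP; rewrite !sf -islinJ.
Qed.

Definition bsym (f : H -> H) :=
  [/\ islin f, exists2 M : R, 0 < M & forall x, nm (f x) <= M * nm x &
      forall x y, ip (f x) y = ip x (f y)].

Lemma hlim_bounded (f : H -> H) (M : R) u l : islin f ->
  (forall x, nm (f x) <= M * nm x) -> hlim u l -> hlim (f \o u) (f l).
Proof.
by move=> lf fM; apply: (hlim_lip (M := M)) => x y; rewrite -islinB.
Qed.

Definition csubspace (M : set H) :=
  M 0 /\ forall (c : R[i]) x y, M x -> M y -> M (c *: x + y).

Definition hclosed (M : set H) :=
  forall u l, (forall n, M (u n)) -> hlim u l -> M l.

Section Subspace.
Variables (M : set H) (sM : csubspace M).

Lemma subspace0 : M 0. Proof. exact: sM.1. Qed.

Lemma subspaceD x y : M x -> M y -> M (x + y).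
Proof. by move=> Mx My; rewrite -[x]scale1r; apply: sM.2. Qed.

Lemma subspaceZ c x : M x -> M (c *: x).
Proof. by move=> Mx; rewrite -[_ *: _]addr0; apply: sM.2 => //; exact: sM.1. Qed.

Lemma subspaceN x : M x -> M (- x).
Proof. by rewrite -scaleN1r; exact: subspaceZ. Qed.

Lemma subspaceB x y : M x -> M y -> M (x - y).
Proof. by move=> Mx /subspaceN; exact: subspaceD. Qed.

End Subspace.

(** A minimizing sequence is Cauchy by the parallelogram identity, because the midpoint of two of
    its terms again lies in [M]. *)
Lemma nearest_point (M : set H) x : csubspace M -> hclosed M ->
  exists2 p, M p & forall m, M m -> ip (x - p) (x - p) <= ip (x - m) (x - m).
Proof.
move=> sM cM.
have [d [dle dadh]] : exists d, (forall m, M m -> d <= ip (x - m) (x - m)) /\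
    forall e, 0 < e -> exists m, M m /\ ip (x - m) (x - m) < d + e.
  pose D := [set ip (x - m) (x - m) | m in M].
  have lbD : lbound D 0 by move=> _ [m _ <-]; exact: ip_ge0.
  have hD : has_inf D.
    by split; [exists (ip (x - 0) (x - 0)), 0 => //; exact: sM.1 | exists 0].
  exists (inf D); split=> [m Mm|e e0]; first by apply: ge_inf; [exists 0 | exists m].
  by have [_ [m Mm <-] lt] := inf_adherent e0 hD; exists m.
have /choice[u hu] n : exists m, M m /\ ip (x - m) (x - m) < d + n.+1%:R^-1.
  by apply: dadh; rewrite invr_gt0.
have uu m n : nm (u m - u n) ^+ 2 <= 2 * (m.+1%:R^-1 + n.+1%:R^-1).
  have [Mm um] := hu m; have [Mn un] := hu n.
  have := dle (((1/2)%:C) *: (u m + u n))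
    (subspaceZ sM _ (subspaceD sM Mm Mn)).
  rewrite (nm2 dot_norm) !ipE (ipC _ (u n) x) (ipC _ (u n) (u m)) (ipC _ (u m) x).
  move: um un; rewrite !ipE (ipC _ (u n) x) (ipC _ (u m) x).
  by move: (_.+1%:R^-1) (_.+1%:R^-1) => a b h1 h2 h3; lra.
have [p up] : exists p, hlim u p.
  apply: hcauchy => // e e0.
  have [N hN] : exists N, forall n, (N <= n)%N -> n.+1%:R^-1 < e ^+ 2 / 4.
    have e2 : 0 < e ^+ 2 / 4 by rewrite divr_gt0// exprn_gt0.
    have [N _ hN] := (cvgrPdist_lt _ _).1 (@cvg_harmonic R) _ e2.
    exists N => n /hN /=; rewrite sub0r normrN gtr0_norm// invr_gt0//.
  exists N => m n Nm Nn; have := uu m n; have := hN _ Nm; have := hN _ Nn.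
  move=> h1 h2 h3; rewrite -(@ltr_pXn2r _ 2) ?nnegrE ?nm_ge0 ?ltW//.
  by move: (m.+1%:R^-1) (n.+1%:R^-1) h1 h2 h3 => a c h1 h2 h3; lra.
exists p; first by apply: cM up => n; case: (hu n).
move=> m Mm; apply: le_trans (dle _ Mm).
have /hlim_sq - /(_ _ dot_norm) h1 : hlim (fun n => x - u n) (x - p).
  exact: hlimB (hlim_cst _) up.
have h2 : (fun n => d + n.+1%:R^-1) @ \oo --> d + 0.
  exact: cvgD (cvg_cst _) (@cvg_harmonic R).
rewrite -[d]addr0; apply: (ler_cvg_to h1 h2).
by apply: nearW => n; apply/ltW; case: (hu n).
Qed.

Lemma orthogonal_decomposition (M : set H) x : csubspace M -> hclosed M ->
  exists2 p, M p & forall m, M m -> ip (x - p) m = 0.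
Proof.
move=> sM cM; have [p Mp pmin] := nearest_point x sM cM; exists p => // m Mm.
apply/eqP; rewrite -sqrf_eq0 eq_le sqr_ge0 andbT.
have [->|m0] := eqVneq m 0; first by rewrite ip0r expr0n.
have mm : 0 < ip m m.
  by rewrite lt_neqAle ip_ge0// andbT eq_sym; apply: contra_neq m0 => mm;
     apply: ip_eq0 => //; rewrite mm.
pose t := ip (x - p) m / ip m m.
have := pmin (p + t%:C *: m) (subspaceD sM Mp (subspaceZ sM _ Mm)).
rewrite opprD addrA.
move: (x - p) @t => y t; rewrite !ipE (ipC _ m y) => h.
have tm : t * ip m m = ip y m by rewrite /t divfK// gt_eqF.
have h2 : t * ip y m <= 0 by rewrite -tm; nra.
by rewrite expr2 -{1}tm mulrAC pmulr_lle0.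
Qed.

(** [M] is stable under [J], so real orthogonality to it is complex orthogonality; this makes the
    projection onto [M] complex linear. *)
Lemma orthogonal_J (M : set H) y : csubspace M ->
  (forall m, M m -> ip y m = 0) -> forall m, M m -> ip (J y) m = 0.
Proof.
by move=> sM yM m Mm; rewrite ipJl yM ?oppr0//; exact: subspaceZ.
Qed.

Lemma projection_theorem (M : set H) : csubspace M -> hclosed M ->
  exists P, [/\ orthogonal_projection dot P, forall x, M (P x) &
    forall x, M x -> P x = x].
Proof.
move=> sM cM.
have /choice[P hP] x : exists p, M p /\ forall m, M m -> ip (x - p) m = 0.
  by have [p] := orthogonal_decomposition x sM cM; exists p.
have uniqP x p : M p -> (forall m, M m -> ip (x - p) m = 0) -> p = P x.
  move=> Mp xp; have [MP xP] := hP x.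
  apply/eqP; rewrite -subr_eq0; apply/eqP/(ip_eq0 dot_norm).
  have Mm := subspaceB sM Mp MP.
  have := xp _ Mm; have := xP _ Mm.
  by rewrite !ipE (ipC _ p (P x)) => h1 h2; lra.
have lP : islin P.
  move=> c x y; apply/esym/uniqP.
    by apply: sM.2; [case: (hP x)|case: (hP y)].
  move=> m Mm; rewrite opprD addrACA -scalerBr scaleE.
  have h z : ip (z - P z) m = 0 by apply: (hP z).2.
  have hJ : ip (J (x - P x)) m = 0.
    by apply: (orthogonal_J sM) => // k Mk; apply: (hP x).2.
  by rewrite !ipDl !ipZl hJ h -ipDl h !mulr0 !addr0.
have PM x : M x -> P x = x.
  by move=> Mx; apply/esym/uniqP => // m _; rewrite subrr ip0l.
exists P; split=> //; last by move=> x; case: (hP x).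
split=> //; first by move=> x; apply: PM; case: (hP x).
apply/symmetric_operatorP => // x y.
have := (hP x).2 _ (hP y).1; have := (hP y).2 _ (hP x).1.
by rewrite !ipDl !ipNl (ipC _ y) (ipC _ (P y) (P x)) => h1 h2; lra.
Qed.

Lemma projection_nm P x : orthogonal_projection dot P -> nm (P x) <= nm x.
Proof.
move=> [lP PP /symmetric_operatorP-/(_ lP) sP].
apply: (le_nm dot_norm); rewrite -[ip x x]addr0.
have := ip_ge0 dot_norm (x - P x).
have h : ip (P x) (P x) = ip x (P x) by rewrite sP PP.
by rewrite !ipE (ipC _ (P x) x) h => *; lra.
Qed.

End LinearFunctions.

(** * Square roots and signs of bounded operators *)

Section BoundedOperators.
Variables (R : realType) (H : completeNormedModType R[i]).
Variables (dot : {dot H for Num.conj}) (dot_norm : induces_norm dot).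
Local Notation ip := (redot dot).

Definition positive (f : H -> H) := forall x, 0 <= ip (f x) x.

(** Nonnegativity of the form at [x - M^-1 f x], with [<f (f x), f x> <= M |f x|^2], leaves this
    bound. It turns information on forms into information on norms. *)
Lemma positive_cauchy_schwarz (f : H -> H) (M : R) x :
  islin f -> (forall x y, ip (f x) y = ip x (f y)) -> positive f ->
  0 < M -> (forall x, nm (f x) <= M * nm x) ->
  nm (f x) ^+ 2 <= M * ip (f x) x.
Proof.
move=> lf sf pf M0 fM.
have := pf (x - (M^-1)%:C *: f x).
rewrite islinB// islinZ// !ipE (sf (f x) x) -(nm2 dot_norm).
have h : ip (f (f x)) (f x) <= M * nm (f x) ^+ 2.
  apply: le_trans (cauchy_schwarz dot_norm _ _) _.
  by rewrite expr2 mulrA ler_wpM2r ?nm_ge0.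
move: (nm (f x) ^+ 2) (ip (f (f x)) (f x)) (ip (f x) x) h => a b c h h2.
have : M^-1 * b <= a by rewrite mulrC ler_pdivrMr// mulrC.
move: h2; rewrite -subr_ge0 => h2 h3.
have h4 : M^-1 * a <= c.
  suff : M^-1 * (M^-1 * b) <= M^-1 * a by lra.
  by rewrite ler_wpM2l// invr_ge0 ltW.
by rewrite -ler_pdivrMl.
Qed.

(** The differences [Y n - Y m] have norm at most 2, so their squared norms at [x] are at most twice
    the increments of the forms, which increase and stay bounded. *)
Lemma monotone_limit (Y : nat -> H -> H) :
  (forall n, islin (Y n)) ->
  (forall n x y, ip (Y n x) y = ip x (Y n y)) ->
  (forall n, positive (fun x => Y n.+1 x - Y n x)) ->
  (forall n x, nm (Y n x) <= nm x) ->
  exists Z : H -> H, [/\ islin Z, forall x, hlim (Y ^~ x) (Z x),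
    forall x y, ip (Z x) y = ip x (Z y) & forall x, nm (Z x) <= nm x].
Proof.
move=> lY sY pY bY.
pose q x n := ip (Y n x) x.
have qS x : nondecreasing_seq (q x).
  apply/nondecreasing_seqP => n; have := pY n x.
  by rewrite ipDl ipNl subr_ge0.
have pYmn m n : (m <= n)%N -> positive (fun x => Y n x - Y m x).
  by move=> mn x; rewrite ipDl ipNl subr_ge0; exact: qS.
have qb x n : q x n <= nm x ^+ 2.
  apply: le_trans (cauchy_schwarz dot_norm _ _) _.
  by rewrite expr2 ler_wpM2r ?nm_ge0.
have YY x m n : (m <= n)%N -> nm (Y n x - Y m x) ^+ 2 <= 2 * (q x n - q x m).
  move=> mn; rewrite /q -ipNl -ipDl.
  apply: (@positive_cauchy_schwarz (fun x => Y n x - Y m x)) => //.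
  - exact: islin_sub.
  - by move=> a b; rewrite !ipE !sY.
  - exact: pYmn.
  - move=> a; apply: le_trans (nmD _ _) _; rewrite nmN.
    by rewrite mulr_natl mulr2n lerD.
have /choice[Z hZ] x : exists l, hlim (Y ^~ x) l.
  exact: (monotone_cauchy (qS x) (qb x) (YY x)).
exists Z; split => //.
- move=> c x y.
  have h1 := hlimD (hlimZ (complex.Re c) (hZ x))
    (hlimZ (complex.Im c) (hlimJ dot_norm (hZ x))).
  have := hlimD h1 (hZ y); have := hZ (c *: x + y).
  rewrite -scaleE.
  have -> : (Y ^~ (c *: x + y)) = (fun n => ((complex.Re c)%:C *: Y n x +
      (complex.Im c)%:C *: J (Y n x)) + Y n y).
    by apply/funext => n; rewrite lY scaleE.
  by move=> h2 h3; exact: hlim_unique h2 h3.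
- move=> x y; have h1 := hlim_ip dot_norm (y := y) (hZ x).
  have h2 := hlim_ip dot_norm (y := x) (hZ y).
  rewrite [RHS]ipC; apply: (cvg_unique _ h1) => //.
  suff <- : (fun n => ip (Y n y) x) = (fun n => ip (Y n x) y) by [].
  by apply/funext => n; rewrite sY ipC.
- move=> x; apply: (ler_cvg_to (hlim_nm (hZ x)) (cvg_cst (nm x))).
  exact: nearW.
Qed.

Section SquareRoot.
Variable X : H -> H.
Hypothesis lX : islin X.
Hypothesis sX : forall x y, ip (X x) y = ip x (X y).
Hypothesis pX : positive X.
Hypothesis bX : forall x, nm (X x) <= nm x.

(* Polynomials in [X] with nonnegative coefficients: they are nonnegative
   operators and stable under composition, which replaces the theorem that a
   product of commuting nonnegative operators is nonnegative. *)
Inductive cone : (H -> H) -> Prop :=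
| cone_pow (c : R) k : 0 <= c -> cone (fun x => c%:C *: iter k X x)
| cone_add f g : cone f -> cone g -> cone (fun x => f x + g x).

Lemma islin_iter k : islin (iter k X).
Proof. by elim: k => [|k ih] c x y //=; rewrite ih lX. Qed.

Lemma iter_sym k x y : ip (iter k X x) y = ip x (iter k X y).
Proof. by elim: k x y => [|k ih] x y //=; rewrite sX ih -iterS iterSr. Qed.

(** Even powers give [<X^j x, X^j x>], odd ones [<X X^j x, X^j x>]; carrying two consecutive
    exponents lets the induction advance by two. *)
Lemma iter_pos k : positive (iter k X).
Proof.
suff : positive (iter k X) /\ positive (iter k.+1 X) by case.
elim: k => [|k [ih1 ih2]]; first by split=> x; [exact: ip_ge0|exact: pX].
split=> // x; rewrite iterS iterSr sX; exact: ih1.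
Qed.

Lemma cone_islin f : cone f -> islin f.
Proof.
elim=> [c k _|g h _ lg _ lh]; last exact: islin_add.
exact/islin_scale/islin_iter.
Qed.

Lemma cone_sym f x y : cone f -> ip (f x) y = ip x (f y).
Proof.
elim=> [c k _|g h _ sg _ sh]; last by rewrite !ipE sg sh.
by rewrite !ipE iter_sym.
Qed.

Lemma cone_positive f : cone f -> positive f.
Proof.
elim=> [c k c0|g h _ pg _ ph] x; last by rewrite ipDl addr_ge0.
by rewrite ipZl mulr_ge0//; exact: iter_pos.
Qed.

Lemma cone_commute f S : islin S -> (forall x, S (X x) = X (S x)) ->
  cone f -> forall x, S (f x) = f (S x).
Proof.
move=> lS SX; elim=> [c k _|g h _ sg _ sh] x; last by rewrite islinD// sg sh.
by rewrite islinZ//; congr (_ *: _); elim: k => //= k <-.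
Qed.

Lemma cone_scale f (a : R) : 0 <= a -> cone f -> cone (fun x => a%:C *: f x).
Proof.
move=> a0; elim=> [c k c0|g h _ cg _ ch].
  have -> : (fun x => a%:C *: (c%:C *: iter k X x)) =
            (fun x => (a * c)%:C *: iter k X x).
    by apply/funext => x; rewrite scalerA rmorphM.
  by apply: cone_pow; exact: mulr_ge0.
have -> : (fun x => a%:C *: (g x + h x)) =
          (fun x => a%:C *: g x + a%:C *: h x).
  by apply/funext => x; rewrite scalerDr.
exact: cone_add.
Qed.

Lemma cone_comp f g : cone f -> cone g -> cone (f \o g).
Proof.
move=> + cg; elim=> [c k c0|f1 f2 _ c1 _ c2]; last exact: (cone_add c1 c2).
elim: cg => [d l d0|g1 g2 _ c1 _ c2].
  have -> : (fun x => c%:C *: iter k X x) \o (fun x => d%:C *: iter l X x) =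
            (fun x => (c * d)%:C *: iter (k + l) X x).
    apply/funext => x /=; rewrite islinZ ?scalerA ?rmorphM ?iterD//.
    exact: islin_iter.
  by apply: cone_pow; exact: mulr_ge0.
have -> : (fun x => c%:C *: iter k X x) \o (fun x => g1 x + g2 x) =
    (fun x => ((fun x => c%:C *: iter k X x) \o g1) x +
              ((fun x => c%:C *: iter k X x) \o g2) x).
  by apply/funext => x /=; rewrite islinD ?scalerDr//; exact: islin_iter.
exact: cone_add.
Qed.

Fixpoint sqrt_iter n (x : H) : H :=
  if n is m.+1 then (2^-1 : R)%:C *: (X x + sqrt_iter m (sqrt_iter m x)) else 0.

Lemma cone_X : cone X.
Proof.
have -> : X = (fun x => (1 : R)%:C *: iter 1 X x).
  by apply/funext => x; rewrite scale1r.
exact: cone_pow.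
Qed.

Lemma cone_sqrt_iter n : cone (sqrt_iter n) /\
  cone (fun x => sqrt_iter n.+1 x - sqrt_iter n x).
Proof.
have h2 : 0 <= 2^-1 :> R by rewrite invr_ge0.
elim: n => [|n [cY cD]].
  split.
    have -> : sqrt_iter 0 = (fun x => (0 : R)%:C *: iter 0 X x).
      by apply/funext => x; rewrite scale0r.
    exact: cone_pow.
  have -> : (fun x => sqrt_iter 1 x - sqrt_iter 0 x) =
            (fun x => (2^-1 : R)%:C *: X x).
    by apply/funext => x /=; rewrite subr0 addr0.
  exact/cone_scale/cone_X.
set D := (fun x => _) in cD.
have YD : sqrt_iter n.+1 = (fun x => sqrt_iter n x + D x).
  by apply/funext => x; rewrite /D subrKC.
split; first by rewrite YD; exact: cone_add.
(* Writing the next iterate as [Y + D], half of [(Y + D)^2 - Y^2] is half of [Y D + D Y + D^2],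
   where no minus sign is left. *)
have -> : (fun x => sqrt_iter n.+2 x - sqrt_iter n.+1 x) =
    (fun x => (2^-1 : R)%:C *:
       ((sqrt_iter n \o D) x + ((D \o sqrt_iter n) x + (D \o D) x))).
  have lY := cone_islin cY; have lD := cone_islin cD.
  have YS m y : sqrt_iter m.+1 y =
      (2^-1 : R)%:C *: (X y + sqrt_iter m (sqrt_iter m y)) by [].
  have Y2 x : sqrt_iter n.+2 x = (2^-1 : R)%:C *:
      (X x + (sqrt_iter n (sqrt_iter n x + D x) + D (sqrt_iter n x + D x))).
    by rewrite (YS n.+1) YD.
  apply/funext => x; rewrite Y2 (YS n x) -scalerBr; congr (_ *: _).
  move: (sqrt_iter n) (D) lY lD => f g lf lg /=.
  rewrite opprD addrACA subrr add0r (islinD lf) (islinD lg).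
  by rewrite [LHS]addrC !addrA addNr add0r.
apply: cone_scale => //.
exact: (cone_add (cone_comp cY cD) (cone_add (cone_comp cD cY) (cone_comp cD cD))).
Qed.

Lemma sqrt_iter_bound n x : nm (sqrt_iter n x) <= nm x.
Proof.
elim: n x => [|n ih] x /=; first by rewrite nm0 nm_ge0.
rewrite nmZ ger0_norm ?invr_ge0// mulrC ler_pdivrMr// mulr_natr mulr2n.
by apply: le_trans (nmD _ _) _; rewrite lerD// (le_trans (ih _)).
Qed.

(* The square root of [1 - X], as [1 - Y] with [Y = (X + Y^2) / 2] the limit
   of the increasing sequence [sqrt_iter]. *)
Lemma square_root : exists Z : H -> H,
  [/\ islin Z, forall x y, ip (Z x) y = ip x (Z y), positive Z,
      forall x, Z (Z x) = x - X x &
      forall S M, islin S -> (forall x, nm (S x) <= M * nm x) ->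
        (forall x, S (X x) = X (S x)) -> forall x, S (Z x) = Z (S x)].
Proof.
have [||||Y [lY YY sY bY]] := @monotone_limit sqrt_iter.
- by move=> n; apply/cone_islin; case: (cone_sqrt_iter n).
- by move=> n x y; apply: cone_sym; case: (cone_sqrt_iter n).
- by move=> n; apply: cone_positive; case: (cone_sqrt_iter n).
- exact: sqrt_iter_bound.
have Yfix x : (2 : R)%:C *: Y x = X x + Y (Y x).
  have h1 : hlim (fun n => sqrt_iter n.+1 x) (Y x).
    rewrite /hlim (cvg_shiftS (fun n => nm (sqrt_iter n x - Y x))).
    exact: YY.
  have h2 : hlim (fun n => sqrt_iter n (sqrt_iter n x)) (Y (Y x)).
    apply: (@hlim_le _ _ _ _ (fun n => nm (sqrt_iter n x - Y x) +
        nm (sqrt_iter n (Y x) - Y (Y x)))) => [n|]; last first.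
      by rewrite -[0](addr0 0); exact: (cvgD (YY x) (YY (Y x))).
    have ln : islin (sqrt_iter n) by apply: cone_islin; case: (cone_sqrt_iter n).
    have := nmD (sqrt_iter n (sqrt_iter n x - Y x))
                (sqrt_iter n (Y x) - Y (Y x)).
    rewrite {1}(islinB ln) subrKA => /le_trans; apply.
    by rewrite lerD2r sqrt_iter_bound.
  have h3 := hlimZ (2^-1) (hlimD (hlim_cst (X x)) h2).
  rewrite {1}(hlim_unique h1 h3).
  by rewrite scalerA -rmorphM mulfV// scale1r.
exists (fun x => x - Y x); split.
- exact: islin_sub.
- by move=> x y; rewrite !ipE sY.
- move=> x; rewrite ipDl ipNl subr_ge0 -(nm2 dot_norm) expr2.
  by apply: le_trans (cauchy_schwarz dot_norm _ _) _; rewrite ler_wpM2r ?nm_ge0.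
- move=> x; have := Yfix x; rewrite rmorphMn /= scaler_nat mulr2n => h.
  have -> : X x = Y x + Y x - Y (Y x) by rewrite h addrK.
  by rewrite islinB// !opprB opprD addrACA -addrA.
- move=> S M lS bS SX x; rewrite islinB//; congr (_ - _).
  apply: (@hlim_unique _ _ (fun n => S (sqrt_iter n x))).
    exact: (hlim_bounded lS bS (YY x)).
  have := YY (S x); congr hlim; apply/funext => n /=.
  by rewrite -(cone_commute lS SX)//; case: (cone_sqrt_iter n).
Qed.

End SquareRoot.

(** As [S'] preserves the range of [P], its adjoint [S] preserves the orthogonal complement;
    preserving the range too, [S] commutes with [P]. *)
Lemma projection_commute P S S' : orthogonal_projection dot P -> islin S ->
  (forall x y, ip (S x) y = ip x (S' y)) ->
  (forall x, P x = x -> P (S x) = S x) ->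
  (forall x, P x = x -> P (S' x) = S' x) ->
  forall x, P (S x) = S (P x).
Proof.
move=> [lP PP /symmetric_operatorP-/(_ lP) sP] lS SS PS PS' x.
have h : P (S (x - P x)) = 0.
  apply: (@ip_inj _ _ dot) => // z; rewrite ip0r -sP ipC SS -PS' ?PP//.
  by rewrite -sP islinB// PP subrr ip0l.
rewrite -[x in LHS](subrK (P x)) islinD// islinD// h add0r.
by rewrite PS// PP.
Qed.

(* [P] projects onto the kernel of [|T| + T], where [|T|] is the square root of
   [T^2]; as [(|T| + T) (|T| - T) = 0], [|T| = T] on the orthogonal complement. *)
Lemma sign_splitting T : bsym dot T ->
  exists P, [/\ orthogonal_projection dot P,
    forall x, P x = x -> ip (T x) x <= 0,
    forall x, P x = 0 -> 0 <= ip (T x) x,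
    forall x, T x = 0 -> P x = x &
    forall S S', islin S -> bounded_operator S -> islin S' ->
      bounded_operator S' -> (forall x y, ip (S x) y = ip x (S' y)) ->
      (forall x, S (T x) = T (S x)) -> (forall x, S' (T x) = T (S' x)) ->
      forall x, P (S x) = S (P x)].
Proof.
move=> [lT [M M0 bT] sT].
(* [T] is rescaled to a contraction [U], so that [0 <= 1 - U^2 <= 1] and [square_root] yields [Z]
   with [Z^2 = U^2], the modulus of [U]. *)
pose U x := (M^-1)%:C *: T x.
have Ui : 0 <= M^-1 by rewrite invr_ge0 ltW.
have lU : islin U by exact: islin_scale.
have sU x y : ip (U x) y = ip x (U y) by rewrite !ipE sT.
have bU x : nm (U x) <= nm x.
  by rewrite nmZ ger0_norm// mulrC ler_pdivrMr// mulrC.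
have TU x : T x = M%:C *: U x.
  by rewrite scalerA -rmorphM divff ?scale1r// gt_eqF.
have UT x : T x = 0 -> U x = 0 by rewrite /U => ->; rewrite scaler0.
have cU V : islin V -> (forall x, V (T x) = T (V x)) ->
    forall x, V (U x) = U (V x).
  by move=> lV VT x; rewrite /U islinZ// VT.
clearbody U.
pose X x := x - U (U x).
have lX : islin X by apply: islin_sub => //; exact: islin_comp.
have [||||Z [lZ sZ pZ ZZ cZ]] := @square_root X.
- exact: lX.
- by move=> x y; rewrite !ipE !sU.
- move=> x; rewrite ipDl ipNl subr_ge0 sU -!nm2//.
  by rewrite ler_sqr ?nnegrE ?nm_ge0.
- move=> x; apply: (le_nm dot_norm).
  have : ip (U (U x)) (U (U x)) <= ip (U x) (U x).
    by rewrite -!nm2// ler_sqr ?nnegrE ?nm_ge0.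
  rewrite !ipE (ipC _ x (U (U x))) (sU (U x) x).
  by have := ip_ge0 dot_norm (U x) => *; lra.
have {}ZZ x : Z (Z x) = U (U x) by rewrite ZZ /X opprB addrC subrK.
have ZU x : U (Z x) = Z (U x).
  by apply: (cZ U 1) => // y; rewrite ?mul1r// /X !islinB.
pose N := [set x | Z x + U x = 0].
have sN : csubspace N.
  split=> [|c x y] /=; first by rewrite /N /= (islin0 lZ) (islin0 lU) addr0.
  by rewrite /N /= => Nx Ny; rewrite lZ lU addrACA -scalerDr Nx Ny scaler0 addr0.
have [mz mz0 bZ] : exists2 M : R, 0 < M & forall x, nm (Z x) <= M * nm x.
  exists 1 => // x; rewrite mul1r; apply: (le_nm dot_norm).
  by rewrite sZ ZZ -sU -!nm2// ler_sqr ?nnegrE ?nm_ge0.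
have cN : hclosed N.
  move=> u l uN ul; have h1 := hlim_bounded lZ bZ ul.
  have bU1 x : nm (U x) <= 1 * nm x by rewrite mul1r.
  have := hlimD h1 (hlim_bounded lU bU1 ul).
  by under eq_fun do rewrite /= uN; move=> h; exact: hlim_unique h (hlim_cst _).
have [P [oP NP PN]] := projection_theorem dot_norm sN cN.
have [lP PP /symmetric_operatorP-/(_ lP) sP] := oP.
exists P; split => //.
- move=> x Px; have := NP x; rewrite Px /N /= => /eqP.
  rewrite addr_eq0 => /eqP h; rewrite TU ipZl.
  rewrite pmulr_rle0// -[U x]opprK -h ipNl oppr_le0; exact: pZ.
- move=> x Px; rewrite TU ipZl pmulr_rge0//.
  suff -> : U x = Z x by exact: pZ.
  apply: (ip_inj dot_norm) => y; apply/eqP; rewrite -subr_eq0; apply/eqP.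
  rewrite -sU -sZ -ipNl -ipDl.
  have Ny : N (Z y - U y).
    by rewrite /N /= (islinB lZ) (islinB lU) ZZ ZU addrA subrK subrr.
  by rewrite -opprB ipNl -(PN _ Ny) sP Px ip0r oppr0.
- move=> x Tx; have Ux := UT _ Tx.
  apply: PN; rewrite /N /= Ux addr0; apply: (ip_eq0 dot_norm).
  by rewrite sZ ZZ Ux islin0// ip0r.
- move=> S S' lS bS lS' bS' SS ST ST'.
  (* A bounded [V] commuting with [T] commutes with [U] and, through [X], with [Z]; hence it
     preserves the kernel [N] of [Z + U]. *)
  have comm V : islin V -> bounded_operator V -> (forall x, V (T x) = T (V x)) ->
      forall x, P x = x -> P (V x) = V x.
    move=> lV /bounded_operatorP[m m0 bV] VT x Px.
    have VU := cU V lV VT.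
    have VZ y : V (Z y) = Z (V y).
      by apply: (cZ V m) => // z; rewrite /X islinB// !VU.
    have := NP x; rewrite Px /N /= => h; apply: PN.
    by rewrite /N /= -VZ -VU -islinD// h islin0.
  by apply: (projection_commute oP lS SS); exact: comm.
Qed.

End BoundedOperators.

(** * Self-adjoint operators and resolvents *)

Section SelfAdjoint.
Variables (R : realType) (H : completeNormedModType R[i]).
Variables (dot : {dot H for Num.conj}) (dot_norm : induces_norm dot).
Local Notation ip := (redot dot).

Section OperatorTheory.
Variable A : operator H.

Lemma dom_subspace : csubspace (dom A).
Proof. by split; [exact: dom0|exact: domP]. Qed.

Lemma app0 : A 0 = 0.
Proof.
have := app_linear (1 : R[i]) (dom0 A) (dom0 A).
rewrite !scale1r add0r => /eqP.
by rewrite -{1}[A 0]addr0 (inj_eq (addrI _)) eq_sym => /eqP.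
Qed.

Lemma appD x y : dom A x -> dom A y -> A (x + y) = A x + A y.
Proof.
by move=> Ax Ay; rewrite -[x in LHS]scale1r app_linear// scale1r.
Qed.

Lemma appZ (c : R[i]) x : dom A x -> A (c *: x) = c *: A x.
Proof.
move=> Ax; rewrite -[c *: x]addr0 app_linear//; last exact: dom0.
by rewrite app0 addr0.
Qed.

Lemma appN x : dom A x -> A (- x) = - A x.
Proof. by move=> Ax; rewrite -scaleN1r appZ// scaleN1r. Qed.

Lemma appB x y : dom A x -> dom A y -> A (x - y) = A x - A y.
Proof.
by move=> Ax Ay; rewrite appD ?appN//; exact: (subspaceN dom_subspace).
Qed.

Lemma domJ x : dom A x -> dom A (J x).
Proof. exact: (subspaceZ dom_subspace). Qed.

Lemma appJ x : dom A x -> A (J x) = J (A x).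
Proof. exact: appZ. Qed.

End OperatorTheory.

Lemma ip_conj (c : R[i]) x y : ip (c *: x) y = ip x (c^* *: y).
Proof. by rewrite !(scaleE c) !(scaleE c^*) !ipE ipJl; case: c => a b /=; ring. Qed.

Section Theory.
Variables (A : operator H) (saA : self_adjoint dot A).

Lemma dense_dom x (e : R) : 0 < e -> exists2 y, dom A y & nm (x - y) < e.
Proof.
move=> e0; have [] := saA.1 (ball x e%:C).
- by exists x; apply: ballxx; rewrite ltcR.
- by apply: ball_open; rewrite ltcR.
- by move=> y [+ Ay]; rewrite -ball_normE /= normE ltcR; exists y.
Qed.

Lemma sa_sym x y : dom A x -> dom A y -> ip (A x) y = ip x (A y).
Proof.
move=> Ax Ay; have [_ h] := saA.2 y (A y).
by have := h (conj Ay erefl) x Ax; rewrite /redot => ->.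
Qed.

Lemma sa_max y z : (forall x, dom A x -> ip (A x) y = ip x z) ->
  dom A y /\ A y = z.
Proof.
move=> h; apply: (saA.2 y z).1 => x Ax; apply/dot_ipP; split; first exact: h.
apply: oppr_inj; rewrite -!ipJl -appJ// h//; exact: domJ.
Qed.

Lemma sa_closed u x z : (forall n, dom A (u n)) -> hlim u x ->
  hlim (fun n => A (u n)) z -> dom A x /\ A x = z.
Proof.
move=> Au ux Auz; apply: sa_max => y Ay.
have h1 := hlim_ip dot_norm (y := A y) ux.
have h2 := hlim_ip dot_norm (y := y) Auz.
rewrite ipC [RHS]ipC; apply: (cvg_unique _ h1) => //.
suff -> : (fun n => ip (u n) (A y)) = (fun n => ip (A (u n)) y) by [].
by apply/funext => n; rewrite sa_sym.
Qed.

(** The cross term is a multiple of [<A x - (Re z) x, J x>], which vanishes because symmetry makes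
    [<A x, x>] real. *)
Lemma shift_nm (z : R[i]) x : dom A x ->
  nm (A x - z *: x) ^+ 2 =
  nm (A x - (complex.Re z)%:C *: x) ^+ 2 + complex.Im z ^+ 2 * nm x ^+ 2.
Proof.
move=> Ax; rewrite !(nm2 dot_norm) (scaleE z x).
have h : ip (A x) (J x) = 0.
  have := sa_sym Ax (domJ Ax); rewrite appJ// => h1.
  by have := ipJl dot x (A x); rewrite (ipC _ (J x)) h1 => h2; lra.
rewrite !ipE ipJJ (ipC _ x (A x)) (ipC _ (J x) (A x)) (ipC _ (J x) x) h ipxJ.
by ring.
Qed.

(** The same bound holds at the conjugate of [z], as only the square of the imaginary part enters.
    So [A - z] is injective, its range is closed because [A] is, and a vector orthogonal to the
    range is in the kernel of [A] minus the conjugate of [z], which is zero. *)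
Lemma resolvent_criterion (z : R[i]) (c : R) : 0 < c ->
  (forall x, dom A x -> (c * nm x) ^+ 2 <=
    nm (A x - (complex.Re z)%:C *: x) ^+ 2 + complex.Im z ^+ 2 * nm x ^+ 2) ->
  resolvent_set A z.
Proof.
move=> c0 hz.
have bz x : dom A x -> c * nm x <= nm (A x - z *: x).
  move=> Ax; rewrite -ler_sqr ?nnegrE ?nm_ge0 ?mulr_ge0 ?nm_ge0 ?(ltW c0)//.
  by rewrite shift_nm//; exact: hz.
have bzC x : dom A x -> c * nm x <= nm (A x - z^* *: x).
  move=> Ax; rewrite -ler_sqr ?nnegrE ?nm_ge0 ?mulr_ge0 ?nm_ge0 ?(ltW c0)//.
  rewrite shift_nm//; have := hz _ Ax; case: (z) => a b /=.
  by rewrite sqrrN.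
pose M := [set A x - z *: x | x in dom A].
have subE x y : dom A x -> dom A y ->
    A (x - y) - z *: (x - y) = (A x - z *: x) - (A y - z *: y).
  by move=> Ax Ay; rewrite appB// scalerBr opprD addrACA -opprD.
have sM : csubspace M.
  split=> [|k _ _ [x Ax <-] [y Ay <-]].
    by exists 0; [exact: dom0|rewrite app0 scaler0 subrr].
  exists (k *: x + y); first exact: domP.
  by rewrite app_linear// !scalerDr opprD addrACA scalerN !scalerA (mulrC z).
have cM : hclosed M.
  move=> u l uM ul.
  have /choice[v hv] n : exists x, dom A x /\ A x - z *: x = u n.
    by have [x] := uM n; exists x.
  have Av n : dom A (v n) by case: (hv n).
  have vu n : A (v n) - z *: v n = u n by case: (hv n).
  have [x vx] : exists x, hlim v x.
    apply: hcauchy => // e e0.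
    have ce : 0 < c * e / 2 by rewrite divr_gt0// mulr_gt0.
    have [N _ hN] := (cvgrPdist_lt _ _).1 ul _ ce.
    exists N => m n Nm Nn; rewrite -(ltr_pM2l c0).
    apply: le_lt_trans (bz _ (subspaceB (dom_subspace A) (Av m) (Av n))) _.
    rewrite subE// !vu.
    have := hN m Nm; have := hN n Nn.
    rewrite /= !sub0r !normrN !ger0_norm ?nm_ge0// => h1 h2.
    have := nmD (u m - l) (l - u n); rewrite subrKA (nmB l) => h3.
    by lra.
  have zv : hlim (fun n => z *: v n) (z *: x).
    rewrite (scaleE z x); under eq_fun do rewrite scaleE.
    exact: hlimD (hlimZ _ vx) (hlimZ _ (hlimJ dot_norm vx)).
  have Avl : hlim (fun n => A (v n)) (l + z *: x).
    by have := hlimD ul zv; under eq_fun do rewrite -vu subrK.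
  have [Ax Axe] := sa_closed Av vx Avl.
  by exists x => //; rewrite Axe addrK.
have MT y : M y.
  have [p Mp yp] := orthogonal_decomposition dot_norm y sM cM.
  suff : y - p = 0 by move/eqP; rewrite subr_eq0 => /eqP ->.
  move: (y - p) yp => w wM.
  have [Aw Awe] : dom A w /\ A w = z^* *: w.
    apply: sa_max => x Ax; rewrite -ip_conj; apply/eqP.
    by rewrite -subr_eq0 -ipNl -ipDl ipC wM//; exists x.
  apply: nm_eq0; apply/eqP; rewrite eq_le nm_ge0 andbT.
  by have := bzC _ Aw; rewrite Awe subrr nm0 pmulr_rle0.
have inj x y : dom A x -> dom A y -> A x - z *: x = A y - z *: y -> x = y.
  move=> Ax Ay e; apply/eqP; rewrite -subr_eq0; apply/eqP/nm_eq0.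
  apply/eqP; rewrite eq_le nm_ge0 andbT.
  have := bz _ (subspaceB (dom_subspace A) Ax Ay).
  by rewrite subE// e subrr nm0 pmulr_rle0.
have /choice[T hT] y : exists x, dom A x /\ A x - z *: x = y.
  by have [x] := MT y; exists x.
have lT : islin T.
  move=> k x y; have [ATx Tx] := hT x; have [ATy Ty] := hT y.
  have [ATk Tk] := hT (k *: x + y).
  apply: inj => //; first exact: domP.
  rewrite Tk app_linear// -{1}Tx -{1}Ty.
  by rewrite !scalerDr opprD addrACA scalerN !scalerA (mulrC z).
have [S ST] := linear_of lT.
exists S; split.
- apply/bounded_operatorP; exists c^-1; first by rewrite invr_gt0.
  move=> y; rewrite ST mulrC ler_pdivlMr// mulrC.
  by have [ATy Ty] := hT y; have := bz _ ATy; rewrite Ty.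
- by move=> y; rewrite ST.
- move=> x Ax; rewrite ST; have [ATx Tx] := hT (A x - z *: x); exact: inj.
Qed.

Lemma resolvent_bound (z : R[i]) : resolvent_set A z ->
  exists2 c : R, 0 < c & forall x, dom A x -> c * nm x <= nm (A x - z *: x).
Proof.
move=> [T [/bounded_operatorP[M M0 bT] _ TA]].
exists M^-1 => [|x Ax]; first by rewrite invr_gt0.
by rewrite ler_pdivrMl//; have := bT (A x - z *: x); rewrite TA.
Qed.

End Theory.

Lemma self_adjoint_add (A : operator H) (C : {linear H -> H}) :
  self_adjoint dot A -> symmetric_operator dot C ->
  self_adjoint dot (op_add A C).
Proof.
move=> saA sC; split=> [|y z]; first exact: saA.1.
have h : adjoint_graph dot (op_add A C) y z <-> adjoint_graph dot A y (z - C y).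
  split=> h x Ax; have := h x Ax.
    by rewrite /= linearDl linearBr /= -sC => <-; rewrite addrK.
  by rewrite /= linearDl linearBr /= -sC => ->; rewrite subrK.
rewrite h saA.2; split=> -[Ay]; first by move=> e; split=> //=; rewrite e subrK.
by move=> <-; split=> //=; rewrite addrK.
Qed.

End SelfAdjoint.

(** * The spectral theorem *)

Section SpectralFamily.
Variables (R : realType) (H : completeNormedModType R[i]).
Variables (dot : {dot H for Num.conj}) (dot_norm : induces_norm dot).
Local Notation ip := (redot dot).

(* The part of the spectral theorem that does not mention measures: [P e]
   reduces [A], with [A <= e] on its range and [A >= e] on its kernel. *)
Record spectral_family (A : operator H) (P : R -> H -> H) : Prop := {
  sf_proj : forall e, orthogonal_projection dot (P e);
  sf_dom : forall e x, dom A x -> dom A (P e x);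
  sf_comm : forall e x, dom A x -> A (P e x) = P e (A x);
  sf_le : forall e x, dom A x -> P e x = x -> ip (A x) x <= e * ip x x;
  sf_ge : forall e x, dom A x -> P e x = 0 -> e * ip x x <= ip (A x) x;
  sf_mono : forall e e' x, e <= e' -> P e' (P e x) = P e x
}.

Section Existence.
Variables (A : operator H) (saA : self_adjoint dot A).

Lemma resolvents_at_i : exists U V : {linear H -> H},
  [/\ bounded_operator U, bounded_operator V,
    forall y, dom A (U y) /\ A (U y) + J (U y) = y,
    (forall x, dom A x -> U (A x + J x) = x) &
    (forall y, dom A (V y) /\ A (V y) - J (V y) = y) /\
    forall x, dom A x -> V (A x - J x) = x].
Proof.
have res (s : R) : s ^+ 2 = 1 -> resolvent_set A (Complex 0 s).
  move=> s1; apply: (resolvent_criterion dot_norm saA ltr01) => x Ax /=.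
  by rewrite scale0r subr0 s1 !mul1r lerDr sqr_ge0.
have iE x : Complex 0 (-1) *: x = - J x :> H.
  by rewrite /J -scaleNr; congr (_ *: _); apply/eqP; rewrite eq_complex /= oppr0 !eqxx.
have [U [bU hU UA]] : resolvent_set A (Complex 0 (-1)) by apply: res; ring.
have [V [bV hV VA]] : resolvent_set A (Complex 0 1) by apply: res; ring.
exists U, V; split=> //.
  by move=> y; have := hU y; rewrite iE opprK.
by move=> x /UA; rewrite iE opprK.
Qed.

(** Used with [p] the norm of a spectral piece of some [x'] in the domain and [K = |A x'|], to let
    the energy cut go to infinity; morally [p <= K / e]. *)
Lemma lt_half_of_quadratic (K p e eps : R) : 0 < eps -> 0 <= K -> 0 <= p ->
  e * p ^+ 2 <= K * p -> 2 * K / eps < e -> p < eps / 2.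
Proof.
move=> eps0 K0 p0 h; rewrite ltr_pdivrMr// => h2; rewrite ltNge; apply/negP => hp.
by have p1 : 0 < p by [lra]; have : e * p <= K by [rewrite -(ler_pM2r p1); nra]; nra.
Qed.

(* [U] and [V] are the inverses of [A + i] and [A - i], so that [T e] is
   [(A - e) / (A^2 + 1)], which has the sign of [A - e]: indeed
   [<(A - e) x, x> = <T e z, z>] for [z = (A + i) x]. *)
Theorem spectral_family_exists : exists P, spectral_family A P /\
  [/\ forall e x, (fun n => nm (P (e + n.+1%:R^-1) x - P e x)) @ \oo --> (0 : R),
      forall x, (fun e => nm (P e x)) @ -oo --> (0 : R) &
      forall x, (fun e => nm (x - P e x)) @ +oo --> (0 : R)].
Proof.
have [U [V [bU bV hU UA [hV VA]]]] := resolvents_at_i.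
have lU := islin_linear U; have lV := islin_linear V.
have UV x y : ip (U x) y = ip x (V y).
  have [Ay {1}<-] := hV y; have [Ax Axe] := hU x.
  rewrite -[in RHS]Axe !ipE ipJl (sa_sym saA)//; ring.
have VU x y : ip (V x) y = ip x (U y) by rewrite ipC -UV ipC.
(* For [w = V (U x)], one has [A^2 w + w = x], so [A - i] maps [A w + i w] to [x]; hence this vector
   is [V x], and [U] sends it to [w]. *)
have comm x : U (V x) = V (U x).
  have [AUx Ux] := hU x; have [Aw Vw] := hV (U x); set w := V (U x) in Aw Vw *.
  have AAw : dom A (A w).
    rewrite -[A w](subrK (J w)) Vw.
    exact: (subspaceD (dom_subspace A) AUx (domJ Aw)).
  have e : V x = A w + J w.
    have Au : dom A (A w + J w) := subspaceD (dom_subspace A) AAw (domJ Aw).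
    have e1 : x = A (A w) + w.
      rewrite -[LHS]Ux -Vw appB// ?appJ//; last exact: domJ.
      by rewrite /J scalerBr -!/(J _) JJ opprK addrA subrK.
    rewrite -(VA _ Au); congr (V _); rewrite [LHS]e1 appD// ?appJ//; last exact: domJ.
    by rewrite /J scalerDr -!/(J _) JJ opprB addrACA subrr addr0.
  by rewrite e UA.
pose T e x := (2^-1 : R)%:C *: (U x + V x) + (- e)%:C *: V (U x).
have lVU : islin (V \o U) by exact: islin_comp.
have lT e : islin (T e).
  by apply: islin_add; apply: islin_scale => //; exact: islin_add.
have sT e x y : ip (T e x) y = ip x (T e y).
  by rewrite !ipE !VU !UV; ring.
have bT e : bsym dot (T e).
  split=> //.
  have [MU MU0 {}bU] := (bounded_operatorP _).1 bU.
  have [MV MV0 {}bV] := (bounded_operatorP _).1 bV.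
  exists (`|2^-1| * (MU + MV) + `|- e| * (MV * MU)) => [|x].
    apply: ltr_wpDr; first by rewrite !mulr_ge0// ltW.
    by rewrite mulr_gt0 ?addr_gt0// normr_gt0 invr_eq0.
  apply: le_trans (nmD _ _) _; rewrite !nmZ mulrDl; apply: lerD.
    rewrite -mulrA ler_wpM2l//; apply: le_trans (nmD _ _) _.
    by rewrite mulrDl lerD.
  rewrite -!mulrA ler_wpM2l//; apply: le_trans (bV _) _.
  by rewrite ler_wpM2l// ltW.
have formT e x : dom A x ->
    ip (T e (A x + J x)) (A x + J x) = ip (A x) x - e * ip x x.
  move=> Ax; have e1 := UA _ Ax.
  have [z zE] : exists z, A x + J x = z by exists (A x + J x).
  rewrite zE in e1 *.
  have -> : ip (T e z) z = ip (U z) z - e * ip (U z) (U z).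
    by rewrite !ipE !VU (ipC _ z (U z)); field.
  by rewrite e1 -zE ipDr ipxJ addr0 (ipC _ x (A x)).
have TU e x : U (T e x) = T e (U x).
  by rewrite /T !(linearD, linearZ) /= !scalerDr !comm.
have TV e x : V (T e x) = T e (V x).
  by rewrite /T !(linearD, linearZ) /= !scalerDr !comm.
have /choice[P hP] e := sign_splitting dot_norm (bT e).
have oP e : orthogonal_projection dot (P e) by case: (hP e).
have lP e : islin (P e) by case: (oP e).
have PP e x : P e (P e x) = P e x by case: (oP e).
have sP e x y : ip (P e x) y = ip x (P e y).
  by have [_ _ /symmetric_operatorP-/(_ (lP e))] := oP e; apply.
have bP e : bounded_operator (P e).
  by apply/bounded_operatorP; exists 1 => // x; rewrite mul1r (projection_nm dot_norm).
have PU e x : P e (U x) = U (P e x).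
  by have [_ _ _ _ h] := hP e; exact: (h U V lU bU lV bV UV (TU e) (TV e)).
have PV e x : P e (V x) = V (P e x).
  by have [_ _ _ _ h] := hP e; exact: (h V U lV bV lU bU VU (TV e) (TU e)).
have PT e e' x : P e (T e' x) = T e' (P e x).
  by rewrite /T (islinD (lP e)) !(islinZ (lP e)) (islinD (lP e)) !PV !PU.
clearbody T.
(* [P e'] is its own adjoint and commutes with [T e], so the commutation clause of [sign_splitting]
   applies to it. *)
have Pcomm e e' x : P e (P e' x) = P e' (P e x).
  by have [_ _ _ _ h] := hP e; 
  exact: (h _ _ (lP e') (bP e') (lP e') (bP e') (sP e') (PT e' e) (PT e' e)).
have domP' e x : dom A x -> dom A (P e x).
  by move=> Ax; rewrite -(UA _ Ax) PU; case: (hU (P e (A x + J x))).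
have commP e x : dom A x -> A (P e x) = P e (A x).
  move=> Ax; have [_] := hU (P e (A x + J x)); rewrite -PU UA//.
  by rewrite (islinD (lP e)) (islinJ (lP e)) => /addIr.
have leP e x : dom A x -> P e x = x -> ip (A x) x <= e * ip x x.
  move=> Ax Px; rewrite -subr_le0 -formT//; have [_ h _ _ _] := hP e; apply: h.
  by rewrite islinD// islinJ// -commP// Px.
have geP e x : dom A x -> P e x = 0 -> e * ip x x <= ip (A x) x.
  move=> Ax Px; rewrite -subr_ge0 -formT//; have [_ _ h _ _] := hP e; apply: h.
  by rewrite islinD// islinJ// -commP// Px app0 /J scaler0 addr0.
(* The part [y] of [P e x] outside the range of [P e'] gives [w = U y] with
   [e' |w|^2 <= <A w, w> <= e |w|^2]; as [e < e'], [w = 0] and so [y = 0]. *)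
have mono e e' x : e <= e' -> P e' (P e x) = P e x.
  rewrite le_eqVlt => /predU1P[->|ee']; first exact: PP.
  apply/eqP; rewrite eq_sym -subr_eq0; apply/eqP.
  set y := _ - _.
  have Py : P e y = y by rewrite /y islinB// Pcomm PP.
  have P'y : P e' y = 0 by rewrite /y islinB// PP subrr.
  have [Aw Awe] := hU y.
  have h1 : P e (U y) = U y by rewrite PU Py.
  have h2 : P e' (U y) = 0 by rewrite PU P'y linear0.
  have w0 : U y = 0.
    apply: (ip_eq0 dot_norm).
    have := le_trans (geP _ _ Aw h2) (leP _ _ Aw h1).
    by have := ip_ge0 dot_norm (U y) => *; nra.
  by rewrite -Awe w0 app0 /J scaler0 addr0.
exists P; split; first by split.
have nP e x : nm (P e x) <= nm x by exact: projection_nm.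
have nQ e x : nm (x - P e x) <= nm x.
  apply: (le_nm dot_norm); have := ip_ge0 dot_norm (P e x).
  have h : ip (P e x) (P e x) = ip x (P e x) by rewrite sP PP.
  by rewrite !ipE (ipC _ (P e x) x) h => *; lra.
split.
(* The vectors [P (e + r n) x] converge to some [g]. The remainder [y = g - P e x] is killed by
   [P e] but kept by every [P e'] with [e < e'], whence [<T e y, y> <= 0]. As [T e] is nonnegative
   on the kernel of [P e], this gives [T e y = 0]; the kernel of [T e] was put into the range of
   [P e], so [y = P e y = 0]. *)
- move=> e x; pose r n : R := n.+1%:R^-1.
  have r0 n : 0 < r n by rewrite invr_gt0.
  have rS m n : (m <= n)%N -> r n <= r m.
    by move=> mn; rewrite lef_pV2 ?posrE// ler_nat.
  have [||||Z [lZ hZ _ _]] :=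
      monotone_limit dot_norm (Y := fun n u => u - P (e + r n) u).
  - by move=> n; apply: islin_sub.
  - by move=> n u v; rewrite !ipE sP.
  - move=> n u; rewrite opprB addrC addrA subrK.
    rewrite ipDl ipNl subr_ge0.
    have sq e' : ip (P e' u) u = nm (P e' u) ^+ 2.
      by rewrite (nm2 dot_norm) -sP PP.
    rewrite !sq ler_sqr ?nnegrE ?nm_ge0//.
    by rewrite -(@mono (e + r n.+1) (e + r n)) ?lerD2l ?rS// Pcomm nP.
  - by move=> n u; exact: nQ.
  have Pg : hlim (fun n => P (e + r n) x) (x - Z x).
    have := hlimB (hlim_cst x) (hZ x).
    by under eq_fun do rewrite opprB subrKC.
  suff <- : x - Z x = P e x by [].
  move: (x - Z x) Pg => g Pg.
  have bP1 e' u : nm (P e' u) <= 1 * nm u by rewrite mul1r.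
  have Peg : P e g = P e x.
    have := hlim_bounded (lP e) (bP1 e) Pg.
    rewrite (_ : _ \o _ = fun=> P e x); last first.
      by apply/funext => n /=; rewrite Pcomm mono// lerDl ltW.
    by move=> h; exact: hlim_unique h (hlim_cst _).
  have Pe'g e' : e < e' -> P e' g = g.
    move=> ee'; have := hlim_bounded (lP e') (bP1 e') Pg.
    have e0 : 0 < e' - e by rewrite subr_gt0.
    have [N _ hN] := (cvgrPdist_lt _ _).1 (@cvg_harmonic R) _ e0.
    move=> h; have h1 : (fun n => nm (P e' (P (e + r (n + N)%N) x) - P e' g))
        @ \oo --> (0 : R).
      by rewrite (cvg_shiftn N (fun n => nm (P e' (P (e + r n) x) - P e' g))).
    have h2 : (fun n => nm (P (e + r (n + N)%N) x - g)) @ \oo --> (0 : R).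
      by rewrite (cvg_shiftn N (fun n => nm (P (e + r n) x - g))).
    apply: (hlim_unique h1); rewrite /hlim.
    rewrite (_ : (fun n => _) = (fun n => nm (P (e + r (n + N)%N) x - g)))//.
    apply/funext => n; rewrite mono// -lerBrDl ltW//.
    have := hN (n + N)%N (leq_addl _ _).
    by rewrite /= sub0r normrN ger0_norm ?invr_ge0.
  apply/eqP; rewrite -subr_eq0; apply/eqP.
  have Py : P e (g - P e x) = 0 by rewrite islinB// PP Peg subrr.
  have Py' e' : e < e' -> P e' (g - P e x) = g - P e x.
    by move=> ee'; rewrite islinB// Pe'g// mono// ltW.
  move: (g - P e x) Py Py' => y Py Py' {g Pg Peg Pe'g hZ}.
  rewrite -Py; apply/esym; have [_ _ Qpos ker _] := hP e; apply: ker.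
  have [Aw Awe] := hU y.
  have q0 : ip (T e y) y <= 0.
    have main d : 0 < d -> ip (T e y) y <= d * ip (U y) (U y).
      move=> d0; rewrite -{1 2}Awe formT//.
      have ed : e < e + d by rewrite ltrDl.
      have := @leP (e + d) _ Aw; rewrite PU Py'// => /(_ erefl).
      by rewrite mulrDl; lra.
    rewrite leNgt; apply/negP => q0.
    have w0 := ip_ge0 dot_norm (U y).
    have w1 : 0 < ip (U y) (U y) + 1 by rewrite ltr_wpDl.
    have := main _ (divr_gt0 q0 (mulr_gt0 (ltr0Sn _ 1) w1)).
    move: q0 w0 w1; move: (ip (T e y) y) (ip (U y) (U y)) => q w q0 w0 w1.
    rewrite mulrAC ler_pdivlMr ?mulr_gt0// => h; 
    by clear -q0 w0 w1 h; nra.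
  (* The compression [T e (1 - P e)] is nonnegative everywhere, so a nonpositive form at [y] forces
     [f y = 0] by [positive_cauchy_schwarz]. *)
  pose f u := T e (u - P e u).
  have lf : islin f.
    by move=> c u v; rewrite /f -[in RHS](lT e); congr (T e _);
      rewrite (lP e) scalerBr opprD addrACA.
  have sf u v : ip (f u) v = ip u (f v).
    by rewrite /f !(islinB (lT e)) !ipE -!PT !sP !sT -PT.
  have pf : positive dot f.
    move=> u; have Pq : P e (u - P e u) = 0 by rewrite islinB// PP subrr.
    suff -> : ip (f u) u = ip (T e (u - P e u)) (u - P e u) by exact: Qpos.
    by rewrite [RHS]ipDr ipNr -sP PT Pq (islin0 (lT e)) ip0l subr0.
  have [_ [M M0 bM] _] := bT e.
  have := positive_cauchy_schwarz dot_norm y lf sf pf M0.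
  have bf u : nm (f u) <= M * nm u.
    by apply: le_trans (bM _) _; rewrite ler_wpM2l// ltW.
  move=> /(_ bf); rewrite /f Py subr0 => h.
  apply/nm_eq0/eqP; rewrite -sqrf_eq0 eq_le sqr_ge0 andbT.
  by apply: le_trans h _; rewrite pmulr_rle0.
(* By density it suffices to treat [x'] in the domain; for very negative [e],
   [- e |P e x'|^2 <= |A x'| |P e x'|] makes [P e x'] small. *)
- move=> x; apply/cvgrPdist_lt => eps eps0.
  have e2 : 0 < eps / 2 by rewrite divr_gt0.
  have [x' Ax' xx'] := dense_dom saA x e2.
  have : \forall e \near -oo, e < - (2 * nm (A x') / eps) by apply: nbhs_ninfty_lt; exact: num_real.
  apply: filterS => e he; rewrite sub0r normrN ger0_norm ?nm_ge0//.
  have := nmD (P e (x - x')) (P e x'); rewrite -islinD// subrK => /le_lt_trans.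
  apply; rewrite [eps]splitr; apply: ltrD; first exact: le_lt_trans (nP _ _) xx'.
  apply: (lt_half_of_quadratic (e := - e) eps0 (nm_ge0 (A x')) (nm_ge0 _)); last by rewrite ltrNr.
  have := cauchy_schwarz dot_norm (- A (P e x')) (P e x').
  rewrite ipNl nmN => h; apply: le_trans (le_trans h _).
    by rewrite mulNr lerN2 (nm2 dot_norm); exact: leP (domP' e _ Ax') (PP e x').
  by rewrite commP// ler_wpM2r ?nm_ge0.
- move=> x; apply/cvgrPdist_lt => eps eps0.
  have e2 : 0 < eps / 2 by rewrite divr_gt0.
  have [x' Ax' xx'] := dense_dom saA x e2.
  have : \forall e \near +oo, 2 * nm (A x') / eps < e by apply: nbhs_pinfty_gt; exact: num_real.
  apply: filterS => e he; rewrite sub0r normrN ger0_norm ?nm_ge0//.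
  have := nmD ((x - x') - P e (x - x')) (x' - P e x').
  rewrite addrACA -opprD -(islinD (lP e)) subrK.
  move=> /le_lt_trans; apply; rewrite [eps]splitr.
  apply: ltrD; first exact: le_lt_trans (nQ _ _) xx'.
  have AQ : dom A (x' - P e x').
    exact: (subspaceB (dom_subspace A) Ax' (domP' e _ Ax')).
  apply: (lt_half_of_quadratic (e := e) eps0 (nm_ge0 (A x')) (nm_ge0 _)) => //.
  have := cauchy_schwarz dot_norm (A (x' - P e x')) (x' - P e x').
  rewrite {2}appB ?commP//; last exact: domP'.
  move=> h; rewrite (nm2 dot_norm); apply: le_trans (geP _ _ AQ _) _.
    by rewrite islinB// PP subrr.
  by apply: le_trans h _; rewrite ler_wpM2r ?nm_ge0.
Qed.

End Existence.
End SpectralFamily.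

(** * Measures on the line and their distribution functions *)

Section Measure.
Variable R : realType.

Lemma le0_harmonic (x K : R) : (forall n, x <= K * n.+1%:R^-1) -> x <= 0.
Proof.
move=> h; rewrite -(mulr0 K).
apply: (ler_cvg_to (cvg_cst x) (cvgM (cvg_cst K) (@cvg_harmonic R))).
exact: nearW.
Qed.

(** Over [n + 1] equal pieces the increments of [D] add up to at most
    [C (d - c) (F d - F c) / (n + 1)], which tends to 0. *)
Lemma small_increments (C c d : R) (D F : R -> R) : c <= d ->
  (forall u v, c <= u -> u <= v -> v <= d ->
     `|D v - D u| <= C * (v - u) * (F v - F u)) ->
  D c = D d.
Proof.
move=> cd h; apply/eqP; rewrite eq_sym -subr_eq0 -normr_le0; apply/eqP/le_anti.
suff : `|D d - D c| <= 0 by move->.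
apply: (@le0_harmonic _ (C * (d - c) * (F d - F c))) => n.
pose s : R := (d - c) * n.+1%:R^-1.
have s0 : 0 <= s by rewrite mulr_ge0// ?invr_ge0// subr_ge0.
have ns : c + n.+1%:R * s = d by rewrite mulrCA mulfV ?mulr1 ?pnatr_eq0// subrKC.
suff H k : (k <= n.+1)%N ->
    `|D (c + k%:R * s) - D c| <= C * s * (F (c + k%:R * s) - F c).
  have := H n.+1 (leqnn _); rewrite ns => /le_trans; apply.
  by rewrite /s mulrA mulrAC.
elim: k => [_|k ih kn]; first by rewrite mul0r addr0 !subrr normr0 mulr0.
have := h (c + k%:R * s) (c + k.+1%:R * s).
rewrite lerDl mulr_ge0// lerD2l ler_wpM2r ?ler_nat// -ns lerD2l ler_wpM2r ?ler_nat//.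
move=> /(_ isT isT isT).
have -> : c + k.+1%:R * s - (c + k%:R * s) = s by rewrite -natr1; ring.
move=> h1; rewrite -(subrKA (D (c + k%:R * s))).
apply: le_trans (ler_normD _ _) _; apply: le_trans (lerD h1 (ih (ltnW kn))) _.
by rewrite -mulrDr subrKA.
Qed.

Lemma measure_of_cdf (F : R -> R) (L : R) :
  {homo F : x y / x <= y} -> right_continuous F ->
  F @ -oo --> (0 : R) -> F @ +oo --> L ->
  exists mu : {measure set R -> \bar R},
    (forall e, mu `]-oo, e]%classic = (F e)%:E) /\ mu setT = L%:E.
Proof.
move=> ndF rcF F0 FL.
have [cF cFE] : exists cF : cumulative R R, cF =1 F.
  by exists (HB.pack_for (cumulative R R) F (isCumulative.Build R _ R F ndF rcF)).
pose nu := lebesgue_stieltjes_measure cF.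
have nuE a b : a <= b -> nu `]a, b]%classic = (F b - F a)%:E.
  move=> ab; rewrite /nu /lebesgue_stieltjes_measure /measure_extension/=.
  by rewrite measurable_mu_extE/= ?wlength_itv_bnd ?cFE//; exact: is_ocitv.
have mid : measurable_fun setT (idfun : measurableTypeR R -> R).
  exact: measurable_id.
(* Pushing forward along the identity moves the Stieltjes measure from the type [measurableTypeR R]
   to [R]. *)
have [mu muP] : exists mu : {measure set R -> \bar R}, forall A, mu A = nu A.
  pose mu0 := pushforward nu (idfun : measurableTypeR R -> R) : {measure set R -> \bar R}.
  by exists (mu0 mid).
have muE a b : a <= b -> mu `]a, b]%classic = (F b - F a)%:E.
  by move=> ab; rewrite muP nuE.
have cN : (fun n : nat => F (- n%:R)) @ \oo --> (0 : R).
  by apply: (cvg_comp _ _ (cvg_comp _ _ cvgr_idn _) F0); rewrite ninfty.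
exists mu; split => [e|].
- rewrite itvNybndEbigcup.
  have h1 : mu `]-n%:R, e]%classic @[n --> \oo] -->
      mu (\bigcup_n `]-n%:R, e]%classic).
    apply: nondecreasing_cvg_mu => //; first exact: bigcup_measurable.
    by move=> *; apply/subsetPset/subset_itv; rewrite leBSide//= lerN2 ler_nat.
  apply: (cvg_unique _ h1) => //.
  have : (F e - F (- n%:R))%:E @[n --> \oo] --> (F e - 0)%:E.
    by apply: cvg_EFin; [exact: nearW|exact: cvgB (cvg_cst _) cN].
  rewrite subr0; apply: cvg_trans; apply: near_eq_cvg; near=> n.
  by rewrite muE// lerNl; near: n; exact: nbhs_infty_ger.
- rewrite -(bigcup_itvT false false).
  have h1 : mu `]-n%:R, n%:R]%classic @[n --> \oo] -->
      mu (\bigcup_n `]-n%:R, n%:R]%classic).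
    apply: nondecreasing_cvg_mu => //; first exact: bigcup_measurable.
    by move=> *; apply/subsetPset/subset_itv; rewrite leBSide//= ?lerN2 ler_nat.
  apply: (cvg_unique _ h1) => //.
  have : (F n%:R - F (- n%:R))%:E @[n --> \oo] --> (L - 0)%:E.
    apply: cvg_EFin; first exact: nearW.
    by apply: cvgB cN; exact: (cvg_comp _ _ cvgr_idn FL).
  rewrite subr0; apply: cvg_trans; apply: near_eq_cvg; near=> n.
  by rewrite muE// ge0_cp.
Unshelve. all: by end_near. Qed.

Lemma measure_itvoc (m : {measure set R -> \bar R}) a b : a <= b ->
    (m `]-oo, b]%classic < +oo)%E ->
    m `]a, b]%classic = (m `]-oo, b]%classic - m `]-oo, a]%classic)%E.
Proof.
move=> ab moo.
have -> : `]a, b]%classic = `]-oo, b] `\` `]-oo, a].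
  by rewrite -[RHS]setCK setCD setCitvl setUC -[LHS]setCK setCitv.
by rewrite measureD ?setIidr//; exact: subset_itvl.
Qed.

(** The intervals ]a, b] are stable under intersection, generate the Borel sets and exhaust the line
    with finite measure. *)
Lemma measure_cdf_unique (mu nu : {measure set R -> \bar R}) :
  (forall e, mu `]-oo, e]%classic = nu `]-oo, e]%classic) ->
  (forall e, (mu `]-oo, e]%classic < +oo)%E) ->
  forall A, measurable A -> mu A = nu A.
Proof.
move=> munu muoo A mA.
apply: (measure_unique (@ocitv R) (fun n => `]-n%:R, n%:R]%classic)) => //.
- exact: ocitvI.
- by move=> n; exact: is_ocitv.
- exact: (bigcup_itvT false false).
- move=> B [[a b] _ <-] /=; have [ab|ba] := leP a b.
    by rewrite !measure_itvoc// -?munu.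
  by rewrite set_itv_ge ?measure0// bnd_simp -leNgt ltW.
- move=> n; apply: le_lt_trans (muoo n%:R).
  by apply: le_measure; rewrite ?inE//; exact: subset_itvr.
Qed.

End Measure.

Section Increments.
Variable R : realType.

(* [G v - G u] and the integral of [f] over ]u, v] are both within
   [C * (v - u)] of [k], up to the factor mu(]u, v]); summing over a subdivision of
   mesh tending to 0 shows that they agree. *)
Lemma integral_of_increments (mu : {measure set R -> \bar R}) (F f G : R -> R)
    (c d C : R) : c <= d -> measurable_fun setT f ->
  (forall u v, u <= v -> mu `]u, v]%classic = (F v - F u)%:E) ->
  (forall u v, c <= u -> u <= v -> v <= d -> exists k,
    `|G v - G u - k * (F v - F u)| <= C * (v - u) * (F v - F u) /\
    forall l, u < l -> l <= v -> `|f l - k| <= C * (v - u)) ->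
  mu.-integrable `]c, d]%classic (EFin \o f) /\
  G d - G c = (\int[mu]_(l in `]c, d]%classic) f l)%R.
Proof.
move=> cd mf muF h.
have itf u v : c <= u -> u <= v -> v <= d ->
    mu.-integrable `]u, v]%classic (EFin \o f).
  move=> cu uv vd; have [k [_ hk]] := h u v cu uv vd.
  apply: measurable_bounded_integrable => //.
  - by rewrite muF// ltry.
  - exact: measurable_funTS.
  - exists (`|k| + C * (v - u)); split; first exact: num_real.
    move=> M hM l /=; rewrite in_itv /= => /andP[ul lv].
    have := hk _ ul lv; have := ler_normD (f l - k) k.
    by rewrite subrK; lra.
have cst u v (r : R) : u <= v -> mu.-integrable `]u, v]%classic (EFin \o cst r).
  move=> uv; apply: measurable_bounded_integrable => //.
  - by rewrite muF// ltry.
  - exists `|r|; split; first exact: num_real.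
    by move=> M hM l _ /=; exact: ltW.
split; first exact: itf.
pose S v := (\int[mu]_(l in `]c, v]%classic) f l)%R.
have S0 : S c = 0 by rewrite /S set_itvoc0 Rintegral_set0.
suff e : G c - S c = G d - S d.
  by rewrite -/(S d); move: e; rewrite S0; lra.
apply: (@small_increments _ (2 * C) c d (fun v => G v - S v) F cd).
move=> u v cu uv vd.
have [k [hG hf]] := h u v cu uv vd.
have SE : S v = S u + (\int[mu]_(l in `]u, v]%classic) f l)%R.
  rewrite /S -Rintegral_setU//.
  - by rewrite -itv_bndbnd_setU.
  - by rewrite -itv_bndbnd_setU//; apply: itf => //; exact: le_trans uv.
  - apply/disj_setPS => y [/=]; rewrite !in_itv/= => /andP[_ yx] /andP[].
    by rewrite ltNge yx.
have Icst r : (\int[mu]_(l in `]u, v]%classic) r)%R = r * (F v - F u).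
  by rewrite Rintegral_cst// muF.
have lo : (k - C * (v - u)) * (F v - F u) <= (\int[mu]_(l in `]u, v]%classic) f l)%R.
  rewrite -Icst; apply: le_Rintegral => //; [exact: cst|exact: itf|].
  move=> l /=; rewrite in_itv /= => /andP[ul lv].
  by have := hf _ ul lv; rewrite ler_distl => /andP[].
have hi : (\int[mu]_(l in `]u, v]%classic) f l)%R <= (k + C * (v - u)) * (F v - F u).
  rewrite -Icst; apply: le_Rintegral => //; [exact: itf|exact: cst|].
  move=> l /=; rewrite in_itv /= => /andP[ul lv].
  by have := hf _ ul lv; rewrite ler_distl => /andP[].
rewrite SE; move: (Rintegral _ _ _) lo hi => I lo hi.
move: hG; rewrite !ler_norml => /andP[h1 h2].
by apply/andP; split; nra.
Qed.

End Increments.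

(** [1 + l^2] dominates [|l|] and all truncations of [l]; this is the bound for dominated
    convergence. *)
Lemma integrable_1Dsq (R : realType) (m : {measure set R -> \bar R}) :
  (m setT < +oo)%E -> (\int[m]_l (l ^+ 2)%:E < +oo)%E ->
  m.-integrable setT (EFin \o (fun l : R => 1 + l ^+ 2)).
Proof.
move=> mT m2.
have i2 : m.-integrable setT (EFin \o (fun l : R => l ^+ 2)).
  apply/integrableP; split; first by apply/measurable_EFinP; exact: exprn_measurable.
  by under eq_integral do rewrite /= ger0_norm ?sqr_ge0//.
have i1 : m.-integrable setT (EFin \o cst (1 : R)).
  apply: measurable_bounded_integrable => //.
  by exists 1; split=> // M hM l _ /=; rewrite normr1 ltW.
exact: integrableD i1 i2.
Qed.

(** * Spectral bands ]u, v] and the size of [A] on them *)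

Section Bands.
Variables (R : realType) (H : completeNormedModType R[i]).
Variables (dot : {dot H for Num.conj}) (dot_norm : induces_norm dot).
Local Notation ip := (redot dot).
Variables (A : operator H) (saA : self_adjoint dot A).
Variables (P : R -> H -> H) (sfP : spectral_family dot A P).

Lemma sf_lin e : islin (P e).
Proof. by case: (sf_proj sfP e). Qed.

Lemma sf_idem e x : P e (P e x) = P e x.
Proof. by case: (sf_proj sfP e). Qed.

Lemma sf_sym e x y : ip (P e x) y = ip x (P e y).
Proof.
by have [lP _ /symmetric_operatorP-/(_ lP)] := sf_proj sfP e; apply.
Qed.

Lemma sf_monor e e' x : e <= e' -> P e (P e' x) = P e x.
Proof.
move=> ee'; apply: (ip_inj dot_norm) => z.
by rewrite -!sf_sym (sf_mono sfP).
Qed.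

(** For [u <= v] this is the spectral projection of [A] onto ]u, v]. *)
Definition band u v x := P v x - P u x.

Lemma band_lin u v : islin (band u v).
Proof. by apply: islin_sub; exact: sf_lin. Qed.

Lemma band_sym u v x y : ip (band u v x) y = ip x (band u v y).
Proof. by rewrite !ipE !sf_sym. Qed.

Lemma band_upper u v x : u <= v -> P v (band u v x) = band u v x.
Proof. by move=> uv; rewrite (islinB (sf_lin v)) sf_idem (sf_mono sfP). Qed.

Lemma band_lower u v x : u <= v -> P u (band u v x) = 0.
Proof. by move=> uv; rewrite (islinB (sf_lin u)) sf_idem sf_monor// subrr. Qed.

Lemma band_fix u v x : P v x = x -> P u x = 0 -> band u v x = x.
Proof. by rewrite /band => -> ->; rewrite subr0. Qed.

Lemma band_idem u v x : u <= v -> band u v (band u v x) = band u v x.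
Proof. by move=> uv; rewrite band_fix ?band_upper ?band_lower. Qed.

Lemma band_sq u v x : u <= v -> ip (band u v x) x = ip (band u v x) (band u v x).
Proof. by move=> uv; rewrite [RHS]band_sym band_idem// -band_sym. Qed.

Lemma band_nm u v x : u <= v -> nm (band u v x) <= nm x.
Proof.
move=> uv; apply: (le_nm dot_norm); have := ip_ge0 dot_norm (x - band u v x).
move: (band u v x) (band_sq x uv) => y h.
by rewrite !ipE (ipC _ x y) h => *; lra.
Qed.

Lemma band_dom u v x : dom A x -> dom A (band u v x).
Proof. by move=> Ax; apply: (subspaceB (dom_subspace A)); exact: (sf_dom sfP). Qed.

Lemma band_comm u v x : dom A x -> A (band u v x) = band u v (A x).
Proof.
by move=> Ax; rewrite appB; [rewrite !(sf_comm sfP)|exact: (sf_dom sfP)|exact: (sf_dom sfP)].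
Qed.

Lemma band_cat u w v x : band u v x = band u w x + band w v x.
Proof. by rewrite /band [RHS]addrC subrKA. Qed.

(* The form of [A - (u + v) / 2] is bounded by [(v - u) / 2] on the band, hence by
   polarization so is its bilinear form, and the norm is reached by letting
   [w] tend to [A y - m y]. *)
Lemma band_bound_dom u v y : dom A y -> P v y = y -> P u y = 0 -> u <= v ->
  nm (A y - ((u + v) / 2)%:C *: y) <= (v - u) / 2 * nm y.
Proof.
move=> Ay Pv Pu uv; set m := (u + v) / 2; set r := (v - u) / 2.
have r0 : 0 <= r by rewrite divr_ge0// subr_ge0.
set z := A y - m%:C *: y.
have Pvz : P v z = z by rewrite /z (islinB (sf_lin v)) (islinZ (sf_lin v)) -(sf_comm sfP)// Pv.
have Puz : P u z = 0.
  by rewrite /z (islinB (sf_lin u)) (islinZ (sf_lin u)) -(sf_comm sfP)// Pu app0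
    scaler0 subr0.
pose q a := ip (A a) a - m * ip a a.
have qle a : dom A a -> P v a = a -> P u a = 0 -> `|q a| <= r * ip a a.
  move=> Aa Pva Pua; have := sf_le sfP Aa Pva; have := sf_ge sfP Aa Pua.
  by rewrite /q /m /r ler_norml => h1 h2; apply/andP; split; lra.
have key w : dom A w -> P v w = w -> P u w = 0 ->
    2 * ip z w <= r * (ip y y + ip w w).
  move=> Aw Pvw Puw.
  have hp : `|q (y + w)| <= r * ip (y + w) (y + w).
    apply: qle; first exact: (subspaceD (dom_subspace A)).
      by rewrite (islinD (sf_lin v)) Pv Pvw.
    by rewrite (islinD (sf_lin u)) Pu Puw addr0.
  have hm : `|q (y - w)| <= r * ip (y - w) (y - w).
    apply: qle; first exact: (subspaceB (dom_subspace A)).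
      by rewrite (islinB (sf_lin v)) Pv Pvw.
    by rewrite (islinB (sf_lin u)) Pu Puw subr0.
  move: hp hm; rewrite !ler_norml => /andP[_ hp] /andP[hm _].
  move: hp hm; rewrite /q /z appD// appB// !ipE (ipC _ w y).
  rewrite (sa_sym saA Aw Ay) (ipC _ w (A y)); lra.
have key' t : 2 * (t * ip z z) <= r * (ip y y + t ^+ 2 * ip z z).
  have /choice[w hw] n : exists w, [/\ dom A w, P v w = w, P u w = 0 &
      nm (w - z) <= n.+1%:R^-1].
    have n0 : 0 < n.+1%:R^-1 :> R by rewrite invr_gt0.
    have [w Aw zw] := dense_dom saA z n0.
    exists (band u v w); split; [exact: band_dom|exact: band_upper|
      exact: band_lower|].
    rewrite -(band_fix Pvz Puz) -(islinB (band_lin u v)).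
    by apply: le_trans (band_nm _ uv) _; rewrite nmB ltW.
  have wz : hlim w z.
    by apply: (hlim_le (b := fun n => n.+1%:R^-1)) => [n|];
      [case: (hw n)|exact: cvg_harmonic].
  have h1 : (fun n => 2 * t * ip (w n) z) @ \oo --> 2 * t * ip z z.
    by apply: cvgM; [exact: cvg_cst|exact: hlim_ip].
  have h2 : (fun n => r * (ip y y + t ^+ 2 * ip (w n) (w n))) @ \oo -->
      r * (ip y y + t ^+ 2 * ip z z).
    apply: cvgM; first exact: cvg_cst.
    apply: cvgD; first exact: cvg_cst.
    by apply: cvgM; [exact: cvg_cst|exact: hlim_sq].
  rewrite mulrA; apply: (ler_cvg_to h1 h2); apply: nearW => n.
  have [Aw Pvw Puw _] := hw n.
  have := key (t%:C *: w n) (subspaceZ (dom_subspace A) _ Aw).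
  rewrite (islinZ (sf_lin v)) Pvw (islinZ (sf_lin u)) Puw scaler0.
  by move=> /(_ erefl erefl); rewrite !ipZl !ipZr (ipC _ z); lra.
have [z0|z0] := eqVneq (nm z) 0; first by rewrite z0 mulr_ge0 ?nm_ge0.
have nz : 0 < nm z by rewrite lt_neqAle eq_sym z0 nm_ge0.
(* The choice [t = |y| / |z|] makes the two terms on the right equal, leaving
   [2 |y| |z| <= 2 r |y|^2]. *)
have := key' (nm y / nm z); rewrite -!(nm2 dot_norm).
have -> : 2 * (nm y / nm z * nm z ^+ 2) = nm y * (2 * nm z) by field.
have -> : r * (nm y ^+ 2 + (nm y / nm z) ^+ 2 * nm z ^+ 2) = nm y * (2 * (r * nm y)).
  by field.
have [y0|y0] := eqVneq (nm y) 0.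
  have ye := nm_eq0 y0.
  by move: z0; rewrite /z ye app0 scaler0 subr0 nm0 eqxx.
by rewrite ler_pM2l ?ler_pM2l// lt_neqAle eq_sym y0 nm_ge0.
Qed.

(** Vectors of the domain close to [y], projected to the band, still tend to [y]; [A - m] is bounded
    on them, so their images converge and closedness of [A] applies. *)
Lemma dom_band u v y : u <= v -> P v y = y -> P u y = 0 -> dom A y.
Proof.
move=> uv Pv Pu.
set m := (u + v) / 2; set r := (v - u) / 2.
have r0 : 0 <= r by rewrite divr_ge0// subr_ge0.
have /choice[w hw] n : exists w, [/\ dom A w, P v w = w, P u w = 0 &
    nm (w - y) <= n.+1%:R^-1].
  have n0 : 0 < n.+1%:R^-1 :> R by rewrite invr_gt0.
  have [w Aw yw] := dense_dom saA y n0.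
  exists (band u v w); split; [exact: band_dom|exact: band_upper|
    exact: band_lower|].
  rewrite -{1}(band_fix Pv Pu) -(islinB (band_lin u v)).
  by apply: le_trans (band_nm _ uv) _; rewrite nmB ltW.
have wy : hlim w y.
  by apply: (hlim_le (b := fun n => n.+1%:R^-1)) => [n|];
    [case: (hw n)|exact: cvg_harmonic].
have [z Az] : exists z, hlim (fun n => A (w n)) z.
  have [l hl] : exists l, hlim (fun n => A (w n) - m%:C *: w n) l.
    apply: hcauchy => // e e0.
    have e1 : 0 < e / (2 * (r + 1)) by rewrite divr_gt0// mulr_gt0// ltr_wpDl.
    have [N _ hN] := (cvgrPdist_lt _ _).1 wy _ e1.
    exists N => p q Np Nq.
    have [Ap Pvp Pup _] := hw p; have [Aq Pvq Puq _] := hw q.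
    have Apq := subspaceB (dom_subspace A) Ap Aq.
    have := band_bound_dom Apq _ _ uv.
    rewrite (islinB (sf_lin v)) (islinB (sf_lin u)) Pvp Pvq Pup Puq subrr.
    move=> /(_ erefl erefl); rewrite -/m -/r appB// scalerBr opprD addrACA -opprD.
    move=> /le_lt_trans; apply.
    have := hN p Np; have := hN q Nq; rewrite /= !sub0r !normrN !ger0_norm ?nm_ge0//.
    rewrite !ltr_pdivlMr ?mulr_gt0 ?ltr_wpDl// => hq hp.
    have := nmD (w p - y) (y - w q); rewrite subrKA (nmB y).
    have := nm_ge0 (w p - w q); nra.
  exists (l + m%:C *: y); have := hlimD hl (hlimZ m wy).
  by under eq_fun do rewrite subrK.
have Aw n : dom A (w n) by case: (hw n).
by have [] := sa_closed dot_norm saA Aw wy Az.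
Qed.

Lemma band_bound u v y : u <= v -> P v y = y -> P u y = 0 ->
  nm (A y - ((u + v) / 2)%:C *: y) <= (v - u) / 2 * nm y.
Proof. by move=> uv Pv Pu; apply: band_bound_dom => //; exact: (dom_band uv). Qed.

End Bands.

(** * From a spectral family to the integrals that represent [A] *)

Section Resolution.
Variables (R : realType) (H : completeNormedModType R[i]).
Variables (dot : {dot H for Num.conj}) (dot_norm : induces_norm dot).
Local Notation ip := (redot dot).
Variables (A : operator H) (saA : self_adjoint dot A).
Variables (P : R -> H -> H) (sfP : spectral_family dot A P).

Lemma cdf_increment u v x : u <= v ->
  ip (P v x) x - ip (P u x) x = nm (band P u v x) ^+ 2.
Proof.
by move=> uv; rewrite (nm2 dot_norm) -(band_sq dot_norm sfP)// ipDl ipNl.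
Qed.

Section Increments.
Variables (x : H) (c : R).

Let dom_c v : c <= v -> dom A (band P c v x).
Proof.
move=> cv; apply: (dom_band dot_norm saA sfP cv).
  exact: (band_upper sfP).
exact: (band_lower dot_norm sfP).
Qed.

(** The pieces below and above [u] lie in the range and the kernel of [P u], which commutes with
    [A], so all mixed terms vanish and quadratic expressions add up over adjacent bands. *)
Let split_at_u u v : c <= u -> u <= v -> exists p q,
  [/\ band P c u x = p, band P u v x = q, band P c v x = p + q &
      [/\ dom A p, dom A q & [/\ ip (A p) q = 0, ip (A q) p = 0 & ip (A p) (A q) = 0]]].
Proof.
move=> cu uv; exists (band P c u x), (band P u v x); split=> //.
  exact: band_cat.
have Ap := dom_c cu.
have Aq : dom A (band P u v x).
  apply: (dom_band dot_norm saA sfP uv); first exact: (band_upper sfP).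
  exact: (band_lower dot_norm sfP).
have Pp := band_upper sfP x cu; have Pq := band_lower dot_norm sfP x uv.
move: (band P c u x) (band P u v x) Ap Aq Pp Pq => p q Ap Aq Pp Pq.
have PAp : P u (A p) = A p by rewrite -(sf_comm sfP)// Pp.
have PAq : P u (A q) = 0 by rewrite -(sf_comm sfP)// Pq app0.
split=> //; split.
- by rewrite -PAp (sf_sym sfP) Pq ip0r.
- by rewrite -Pp -(sf_sym sfP) PAq ip0l.
- by rewrite -PAp (sf_sym sfP) PAq ip0r.
Qed.

Lemma form_increment u v : c <= u -> u <= v ->
  ip (A (band P c v x)) (band P c v x) - ip (A (band P c u x)) (band P c u x) =
  ip (A (band P u v x)) (band P u v x).
Proof.
move=> cu uv; have [p [q [-> -> -> [Ap Aq [pq qp _]]]]] := split_at_u cu uv.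
by rewrite appD// !ipE pq qp; ring.
Qed.

Lemma sq_increment u v : c <= u -> u <= v ->
  nm (A (band P c v x)) ^+ 2 - nm (A (band P c u x)) ^+ 2 =
  nm (A (band P u v x)) ^+ 2.
Proof.
move=> cu uv; have [p [q [-> -> -> [Ap Aq [_ _ pq]]]]] := split_at_u cu uv.
by rewrite appD// !(nm2 dot_norm) !ipE (ipC _ (A q)) pq; ring.
Qed.

End Increments.

Variable mu : H -> {measure set R -> \bar R}.
Hypothesis muE : forall x e, mu x `]-oo, e]%classic = (ip (P e x) x)%:E.
Hypothesis muT : forall x, mu x setT = (ip x x)%:E.
Hypothesis P_Ny : forall x, (fun e => nm (P e x)) @ -oo --> (0 : R).
Hypothesis P_y : forall x, (fun e => nm (x - P e x)) @ +oo --> (0 : R).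

Lemma mu_itvoc x u v : u <= v ->
  mu x `]u, v]%classic = (ip (P v x) x - ip (P u x) x)%:E.
Proof. by move=> uv; rewrite measure_itvoc ?muE ?ltry. Qed.

Lemma form_integral x c d : c <= d ->
  (mu x).-integrable `]c, d]%classic (EFin \o id) /\
  ip (A (band P c d x)) (band P c d x) =
    (\int[mu x]_(l in `]c, d]%classic) l)%R.
Proof.
move=> cd.
have [] := integral_of_increments (mu := mu x) (F := fun e => ip (P e x) x)
  (f := id) (G := fun v => ip (A (band P c v x)) (band P c v x)) (C := 1) cd.
- exact: measurable_id.
- by move=> u v uv; rewrite mu_itvoc.
(* [A] on the band and [l] on ]u, v] both deviate from the midpoint by at most [(v - u) / 2]. *)
- move=> u v cu uv vd; exists ((u + v) / 2).
  rewrite cdf_increment// form_increment// mul1r; split.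
    have Pv := band_upper sfP x uv; have Pu := band_lower dot_norm sfP x uv.
    have h := band_bound dot_norm saA sfP uv Pv Pu.
    move: (band P u v x) h => y h.
    rewrite (nm2 dot_norm) -ipZl -ipNl -ipDl -(nm2 dot_norm).
    apply: le_trans (cauchy_schwarz_abs dot_norm _ _) _.
    rewrite expr2 mulrA ler_wpM2r ?nm_ge0//; apply: le_trans h _.
    by rewrite ler_wpM2r ?nm_ge0//; lra.
  by move=> l ul lv; rewrite ler_norml; apply/andP; split; lra.
move=> hi; rewrite [X in _ - X](_ : _ = 0) ?subr0 => [->|]; first by [].
by rewrite /band subrr app0 ip0l.
Qed.

Lemma sq_integral x c d : c <= d ->
  (mu x).-integrable `]c, d]%classic (EFin \o (fun l => l ^+ 2)) /\
  nm (A (band P c d x)) ^+ 2 = (\int[mu x]_(l in `]c, d]%classic) (l ^+ 2))%R.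
Proof.
(* [M] bounds ]c, d]. With midpoint [m] and half-length [r], [|A y|^2 - m^2 |y|^2 = |A y - m y|^2 +
   2 m <A y - m y, y>] is at most [3 M r |y|^2] in absolute value, and [|l + m| <= 2 M]; the
   constant [3 M] covers both requirements. *)
move=> cd; pose M := `|c| + `|d|.
have M0 : 0 <= M by rewrite addr_ge0.
have [] := integral_of_increments (mu := mu x) (F := fun e => ip (P e x) x)
  (f := fun l => l ^+ 2) (G := fun v => nm (A (band P c v x)) ^+ 2)
  (C := 3 * M) cd.
- exact: exprn_measurable.
- by move=> u v uv; rewrite mu_itvoc.
- move=> u v cu uv vd; exists (((u + v) / 2) ^+ 2).
  have cM : `|c| <= M by rewrite lerDl.
  have dM : `|d| <= M by rewrite lerDr.
  have bnd l : u <= l -> l <= v -> `|l| <= M.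
    move=> ul lv; move: cM dM; rewrite !ler_norml => /andP[? ?] /andP[? ?].
    by apply/andP; split; lra.
  have uM := bnd u (lexx _) uv; have vM := bnd v uv (lexx _).
  have mM : `|(u + v) / 2| <= M by apply: bnd; lra.
  rewrite cdf_increment// sq_increment//; split.
    have Pv := band_upper sfP x uv; have Pu := band_lower dot_norm sfP x uv.
    have h := band_bound dot_norm saA sfP uv Pv Pu.
    move: (band P u v x) h => y.
    set m := (u + v) / 2 in mM *; set r := (v - u) / 2.
    have r0 : 0 <= r by rewrite divr_ge0// subr_ge0.
    have rM : r <= M.
      by move: uM vM; rewrite /r !ler_norml => /andP[? ?] /andP[? ?]; lra.
    have -> : v - u = 2 * r by rewrite /r; field.
    have := cauchy_schwarz_abs dot_norm (A y - m%:C *: y) y.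
    have -> : nm (A y) ^+ 2 - m ^+ 2 * nm y ^+ 2 =
        nm (A y - m%:C *: y) ^+ 2 + 2 * m * ip (A y - m%:C *: y) y.
      by rewrite !(nm2 dot_norm) !ipE (ipC _ y (A y)); ring.
    move: (ip _ _) (nm _) (nm y) (nm_ge0 (A y - m%:C *: y)) (nm_ge0 y) => i z n z0 n0 iz zr.
    have i1 : `|m * i| <= M * (r * n * n).
      by rewrite normrM ler_pM// (le_trans iz)// ler_wpM2r.
    have z2 : z ^+ 2 <= M * (r * n * n).
      apply: (@le_trans _ _ ((r * n) ^+ 2)).
        by rewrite ler_sqr ?nnegrE// mulr_ge0.
      have -> : (r * n) ^+ 2 = r * (r * n * n) by ring.
      by apply: ler_wpM2r => //; exact: mulr_ge0 (mulr_ge0 r0 n0) n0.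
    have z3 := sqr_ge0 z.
    have -> : 3 * M * (2 * r) * n ^+ 2 = 6 * (M * (r * n * n)) by ring.
    have w0 := mulr_ge0 M0 (mulr_ge0 (mulr_ge0 r0 n0) n0).
    rewrite -mulrA; move: (m * i) (M * _) (z ^+ 2) i1 z2 z3 w0 => a b e.
    by rewrite !ler_norml => /andP[? ?] *; apply/andP; split; lra.
  move=> l ul lv; rewrite subr_sqr normrM.
  have lM := bnd l (ltW ul) lv.
  have h1 : `|l - (u + v) / 2| <= v - u.
    by rewrite ler_norml; apply/andP; split; lra.
  have h2 : `|l + (u + v) / 2| <= 3 * M.
    by apply: le_trans (ler_normD _ _) _; lra.
  by rewrite [leRHS]mulrC ler_pM.
move=> hi; rewrite [X in _ - X](_ : _ = 0) ?subr0 => [->|]; first by [].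
by rewrite /band subrr app0 nm0 expr0n.
Qed.

Let measurable_sq (D : set R) : measurable_fun D (fun l : R => (l ^+ 2)%:E).
Proof.
suff : measurable_fun D (EFin \o (fun l : R => l ^+ 2)) by [].
by apply/measurable_EFinP; exact: exprn_measurable.
Qed.

Let I n : set R := `]-n%:R, n%:R]%classic.

Let le_NnR n : - n%:R <= n%:R :> R. Proof. by rewrite ge0_cp. Qed.

Let ndI : {homo I : n m / (n <= m)%N >-> (n <= m)%O}.
Proof.
by move=> m n mn; apply/subsetPset/subset_itv; rewrite leBSide/= ?lerN2 ler_nat.
Qed.

Lemma band_cvg x : hlim (fun n => band P (- n%:R) n%:R x) x.
Proof.
apply: (hlim_le (b := fun n => nm (x - P n%:R x) + nm (P (- n%:R) x))) => [n|].
  have := nmD (- (x - P n%:R x)) (- P (- n%:R) x).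
  by rewrite !nmN opprB addrAC.
rewrite -[0](addr0 0); apply: cvgD.
  exact: (cvg_comp _ _ cvgr_idn (P_y x)).
by apply: (cvg_comp _ _ (cvg_comp _ _ cvgr_idn _) (P_Ny x)); rewrite ninfty.
Qed.

Let band_in_dom n x : dom A (band P (- n%:R) n%:R x).
Proof.
apply: (dom_band dot_norm saA sfP (le_NnR n)).
  exact: (band_upper sfP).
exact: (band_lower dot_norm sfP).
Qed.

Let sq_integralE n x : (\int[mu x]_(l in I n) (l ^+ 2)%:E)%E =
  (nm (A (band P (- n%:R) n%:R x)) ^+ 2)%:E.
Proof.
have [h1 h2] := sq_integral x (le_NnR n).
by rewrite h2 /Rintegral fineK//; exact: integrable_fin_num.
Qed.

Let sq_cvg x : (\int[mu x]_(l in I n) (l ^+ 2)%:E)%E @[n --> \oo] -->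
  (\int[mu x]_l (l ^+ 2)%:E)%E.
Proof.
rewrite -[setT](bigcup_itvT false false).
apply: (@ge0_nondecreasing_set_cvg_integral _ _ _ I (fun l : R => (l ^+ 2)%:E) (mu x)).
- exact: ndI.
- by move=> n; exact: measurable_itv.
- by move=> n; exact: (@measurable_sq _).
- by move=> n l _; rewrite lee_fin sqr_ge0.
Qed.

(** The vector [A x] truncated to ]-n, n] has squared norm the integral of [l^2] over that interval.
    On the domain these are bounded by [|A x|^2]; conversely, a finite integral makes the
    truncations converge, and [A] is closed. *)
Lemma dom_integral x : dom A x <-> (\int[mu x]_l (l ^+ 2)%:E < +oo)%E.
Proof.
split=> [Ax|Ix].
  apply: (@le_lt_trans _ _ (nm (A x) ^+ 2)%:E); last exact: ltry.
  rewrite -(cvg_lim (@ereal_hausdorff _) (@sq_cvg x)); apply: lime_le.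
    by apply/cvg_ex; eexists; exact: sq_cvg.
  apply: nearW => n; rewrite sq_integralE lee_fin (band_comm sfP)//.
  by rewrite ler_sqr ?nnegrE ?nm_ge0// (band_nm dot_norm sfP).
pose J := fine (\int[mu x]_l (l ^+ 2)%:E)%E.
have I0 : (0 <= \int[mu x]_l (l ^+ 2)%:E)%E.
  by apply: integral_ge0 => l _; rewrite lee_fin sqr_ge0.
have JE : (\int[mu x]_l (l ^+ 2)%:E)%E = J%:E by rewrite fineK// ge0_fin_numE.
pose u n := A (band P (- n%:R) n%:R x).
(* A shorter truncation is a projection of a longer one, so squared distances are differences of
   squared norms. *)
have cut m n : (m <= n)%N -> u m = band P (- m%:R) m%:R (u n).
  move=> mn; rewrite /u -(band_comm sfP)//; congr (A _).
  have nm' : m%:R <= n%:R :> R by rewrite ler_nat.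
  have Nm : - n%:R <= - m%:R :> R by rewrite lerN2.
  have mN : - n%:R <= m%:R :> R := le_trans Nm (le_NnR m).
  have Nn : - m%:R <= n%:R :> R := le_trans (le_NnR m) nm'.
  rewrite /band (islinB (sf_lin sfP m%:R)) (islinB (sf_lin sfP (- m%:R))).
  rewrite (sf_monor dot_norm sfP _ nm') (sf_monor dot_norm sfP _ Nn).
  rewrite (sf_mono sfP _ mN) (sf_mono sfP _ Nm).
  by rewrite opprB addrA subrK.
have unm m n : (m <= n)%N -> nm (u n - u m) ^+ 2 = nm (u n) ^+ 2 - nm (u m) ^+ 2.
  move=> mn; rewrite (cut _ _ mn); move: (u n) => y.
  have := band_sq dot_norm sfP y (le_NnR m).
  move: (band P _ _ y) => z h.
  by rewrite !(nm2 dot_norm) !ipE (ipC _ y z) h; ring.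
have [z uz] : exists z, hlim u z.
  apply: (@monotone_cauchy _ _ u (fun n => nm (u n) ^+ 2) J).
  - by apply/nondecreasing_seqP => n; rewrite -subr_ge0 -unm// sqr_ge0.
  - move=> n; rewrite -lee_fin -JE -sq_integralE.
    apply: ge0_subset_integral => //; first exact: measurable_itv.
    by move=> l _; rewrite lee_fin sqr_ge0.
  - move=> m n mn; rewrite -unm//.
    by have := sqr_ge0 (nm (u n - u m)); lra.
by have [] := sa_closed dot_norm saA (fun n => band_in_dom n x) (@band_cvg x) uz.
Qed.

Lemma form_integral_dom x : dom A x -> dot (A x) x = (\int[mu x]_l l)%R%:C.
Proof.
move=> Ax.
have -> : dot (A x) x = (ip (A x) x)%:C.
  apply/eqP; rewrite dot_ip eq_complex /= eqxx andTb; apply/eqP.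
  have := sa_sym saA Ax (domJ Ax); rewrite appJ// => h1.
  by have := ipJl dot x (A x); rewrite (ipC _ (J x)) h1 => h2; lra.
congr (_%:C).
have muTy : (mu x setT < +oo)%E by rewrite muT ltry.
have ig := integrable_1Dsq muTy ((dom_integral x).1 Ax).
have [|||||i0 _ h] := @dominated_convergence _ _ R (mu x) setT measurableT
  (fun n => (EFin \o id) \_ (I n)) (EFin \o id) (EFin \o (fun l : R => 1 + l ^+ 2)).
- move=> n; apply/(measurable_restrictT _ _).1; first exact: measurable_itv.
  by apply/measurable_EFinP; exact: measurable_id.
- by apply/measurable_EFinP; exact: measurable_id.
- apply: aeW => l _; apply: cvg_near_cst; near=> n.
  rewrite patchE mem_set// /I /= in_itv /=.
  have : `|l| < n%:R by near: n; exact: nbhs_infty_gtr.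
  by rewrite ltr_norml => /andP[-> /ltW].
- exact: ig.
- apply: aeW => l n _; rewrite patchE; case: ifPn => _ /=; last first.
    by rewrite normr0 lee_fin addr_ge0 ?sqr_ge0.
  rewrite lee_fin; have := sqr_ge0 (l - 1); have := sqr_ge0 (l + 1).
  by rewrite ler_norml => *; apply/andP; split; nra.
have h1 : (fun n => ip (A (band P (- n%:R) n%:R x)) (band P (- n%:R) n%:R x))
    @ \oo --> ip (A x) x.
  have h2 := hlim_ip dot_norm (y := x) (@band_cvg (A x)).
  rewrite (_ : (fun n => _) = (fun n => ip (band P (- n%:R) n%:R (A x)) x))//.
  by apply/funext => n; rewrite (band_comm sfP)// -(band_sym sfP) (band_idem dot_norm sfP).
apply: (cvg_unique _ h1) => //.
have fE : (\int[mu x]_l l%:E)%E = (\int[mu x]_l l)%R%:E.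
  by rewrite fineK//; exact: integrable_fin_num.
rewrite fE in h; have h3 := fine_cvg h.
suff -> : (fun n => ip (A (band P (- n%:R) n%:R x)) (band P (- n%:R) n%:R x)) =
  fine \o (fun n => \int[mu x]_l (((EFin \o id) \_ (I n)) l))%E by exact: h3.
apply/funext => n /=; have [_ ->] := form_integral x (le_NnR n).
by rewrite -integral_mkcond.
Unshelve. all: by end_near. Qed.

End Resolution.

Theorem resolution_of_identity_exists (R : realType)
    (H : completeNormedModType R[i]) (dot : {dot H for Num.conj})
    (dot_norm : induces_norm dot) (A : operator H) :
  self_adjoint dot A -> exists P, resolution_of_identity dot A P.
Proof.
move=> saA; have [P [sfP [P_rc P_Ny P_y]]] := spectral_family_exists dot_norm saA.
exists P; split; first exact: (sf_proj sfP).
have incr x u v : u <= v -> redot dot (P u x) x <= redot dot (P v x) x.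
  by move=> uv; rewrite -subr_ge0 (cdf_increment dot_norm sfP)// sqr_ge0.
have /choice[mu hmu] x : exists m : {measure set R -> \bar R},
    (forall e, m `]-oo, e]%classic = (redot dot (P e x) x)%:E) /\
    m setT = (redot dot x x)%:E.
  apply: (measure_of_cdf (F := fun e => redot dot (P e x) x)).
  - by move=> u v; exact: incr.
  (* Right continuity of [P] is known only along [e + 1 / (n + 1)]; monotonicity in the energy
     covers the points between. *)
  - move=> e; apply/cvgrPdist_lt => eps eps0.
    have h : (fun n => nm (P (e + n.+1%:R^-1) x - P e x) * nm x) @ \oo --> (0 : R).
      by rewrite -[0](mul0r (nm x)); apply: cvgM; [exact: (P_rc e x)|exact: cvg_cst].
    have [N _ /(_ N (leqnn N)) /=] := (cvgrPdist_lt _ _).1 h _ eps0.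
    rewrite sub0r normrN ger0_norm ?mulr_ge0 ?nm_ge0// => hN.
    near=> y.
    have ey : e < y by near: y; exact: nbhs_right_gt.
    have yN : y < e + N.+1%:R^-1.
      by near: y; apply: nbhs_right_lt; rewrite ltrDl invr_gt0.
    rewrite distrC ger0_norm ?subr_ge0 ?incr ?ltW//.
    apply: le_lt_trans hN; apply: (@le_trans _ _ (redot dot (P (e + N.+1%:R^-1) x) x - redot dot (P e x) x)).
      by rewrite lerD2r incr// ltW.
    by rewrite -ipNl -ipDl; exact: (cauchy_schwarz dot_norm).
  - apply/cvgrPdist_lt => eps eps0.
    have h : (fun e => nm (P e x) * nm x) @ -oo --> (0 : R).
      by rewrite -[0](mul0r (nm x)); apply: cvgM; [exact: (P_Ny x)|exact: cvg_cst].
    move/cvgrPdist_lt : h => /(_ _ eps0); apply: filterS => e.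
    rewrite !sub0r !normrN (ger0_norm (mulr_ge0 (nm_ge0 _) (nm_ge0 _))).
    by apply: le_lt_trans; exact: (cauchy_schwarz_abs dot_norm).
  - apply/cvgrPdist_lt => eps eps0.
    have h : (fun e => nm (x - P e x) * nm x) @ +oo --> (0 : R).
      by rewrite -[0](mul0r (nm x)); apply: cvgM; [exact: (P_y x)|exact: cvg_cst].
    move/cvgrPdist_lt : h => /(_ _ eps0); apply: filterS => e.
    rewrite !sub0r !normrN (ger0_norm (mulr_ge0 (nm_ge0 _) (nm_ge0 _))).
    by apply: le_lt_trans; rewrite -ipNl -ipDl; exact: (cauchy_schwarz_abs dot_norm).
have muE x e : mu x `]-oo, e]%classic = (redot dot (P e x) x)%:E by case: (hmu x).
have muT x : mu x setT = (redot dot x x)%:E by case: (hmu x).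
exists mu; split=> //.
- apply/seteqP; split=> x /=.
    by move/(dom_integral dot_norm saA sfP muE P_Ny P_y).
  by move/(dom_integral dot_norm saA sfP muE P_Ny P_y).
- exact: (form_integral_dom dot_norm saA sfP muE muT P_Ny P_y).
Unshelve. all: by end_near. Qed.

Lemma integrable_id (R : realType) (m : {measure set R -> \bar R}) :
  (m setT < +oo)%E -> (\int[m]_l (l ^+ 2)%:E < +oo)%E ->
  m.-integrable setT (EFin \o id).
Proof.
move=> mT m2.
have ig := integrable_1Dsq mT m2.
apply: le_integrable ig => //.
  by apply/measurable_EFinP; exact: measurable_id.
move=> l _ /=; rewrite lee_fin [leRHS]ger0_norm ?addr_ge0 ?sqr_ge0//.
have := sqr_ge0 (l - 1); have := sqr_ge0 (l + 1).
by rewrite ler_norml => *; apply/andP; split; nra.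
Qed.

(** * From a resolution of the identity back to a spectral family *)

Section OfResolution.
Variables (R : realType) (H : completeNormedModType R[i]).
Variables (dot : {dot H for Num.conj}) (dot_norm : induces_norm dot).
Local Notation ip := (redot dot).
Variables (A : operator H) (saA : self_adjoint dot A).
Variables (P : R -> H -> H).

Lemma ortho_dense z : (forall v, dom A v -> ip z v = 0) -> z = 0.
Proof.
move=> h; apply: (ip_eq0 dot_norm); apply: (@le0_harmonic _ _ (nm z)) => n.
have n0 : 0 < n.+1%:R^-1 :> R by rewrite invr_gt0.
have [w Aw zw] := dense_dom saA z n0.
have := cauchy_schwarz dot_norm z (z - w); rewrite ipDr ipNr (h _ Aw) subr0 => /le_trans.
by apply; rewrite ler_wpM2l ?nm_ge0// ltW.
Qed.

(* The measures at [P e x] and [x - P e x] add up to the measure at [x], as their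
   distribution functions do; so the domain splits, and so does the form, which
   makes [A (P e x)] orthogonal to the kernel of [P e]. *)
Lemma spectral_family_of_resolution :
  resolution_of_identity dot A P -> spectral_family dot A P.
Proof.
move=> [oP [mu [muE muT domE form]]].
have {}muE x e : mu x `]-oo, e]%classic = (ip (P e x) x)%:E by exact: muE.
have {}muT x : mu x setT = (ip x x)%:E by exact: muT.
have lP e : islin (P e) by case: (oP e).
have PP e x : P e (P e x) = P e x by case: (oP e).
have sP e x y : ip (P e x) y = ip x (P e y).
  by have [_ _ /symmetric_operatorP-/(_ (lP e))] := oP e; apply.
have sq e x : ip (P e x) x = nm (P e x) ^+ 2 by rewrite (nm2 dot_norm) -sP PP.
(* The measure at [x - P e' x] vanishes on ]-oo, e'], so on the smaller ]-oo, e]; that is, [P e]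
   kills this vector. *)
have mono' e e' x : e <= e' -> P e (P e' x) = P e x.
  move=> ee'; have h : nm (P e (x - P e' x)) ^+ 2 <= nm (P e' (x - P e' x)) ^+ 2.
    rewrite -!sq -lee_fin -!muE; apply: le_measure; rewrite ?inE//.
    exact: subset_itvl.
  move: h; rewrite (islinB (lP e')) PP subrr nm0 expr0n /= => h.
  have : P e (x - P e' x) = 0.
    by apply: nm_eq0; apply/eqP; rewrite -sqrf_eq0 eq_le h sqr_ge0.
  by rewrite (islinB (lP e)) => /eqP; rewrite subr_eq0 => /eqP.
have mono e e' x : e <= e' -> P e' (P e x) = P e x.
  by move=> ee'; apply: (ip_inj dot_norm) => z; rewrite -!sP mono'.
have Pcomm e e' x : P e (P e' x) = P e' (P e x).
  by have [h|/ltW h] := leP e e'; rewrite (mono _ _ _ h) (mono' _ _ _ h).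
have PQ0 e x : P e (x - P e x) = 0 by rewrite (islinB (lP e)) PP subrr.
have muD e x B : measurable B ->
    mu x B = (mu (P e x) B + mu (x - P e x)%R B)%E.
  move=> mB; rewrite -measure_addE.
  apply: (measure_cdf_unique (nu := measure_add (mu (P e x)) (mu (x - P e x)%R))) => //.
    move=> s; rewrite [RHS]measure_addE !muE -EFinD; congr EFin.
    have h1 : ip (P s (P e x)) x = ip (P s x) (P e x) by rewrite Pcomm sP.
    have h2 : ip (P s (P e x)) (P e x) = ip (P s x) (P e x).
      by rewrite Pcomm sP PP.
    by rewrite (islinB (lP s)) !ipE h1 h2; ring.
  by move=> s; rewrite muE ltry.
have domP e x : dom A x -> dom A (P e x) /\ dom A (x - P e x).
  rewrite domE /=.
  rewrite (eq_measure_integral (measure_add (mu (P e x)) (mu (x - P e x)))); last first.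
    by move=> B mB _; rewrite [RHS]measure_addE; exact: muD.
  rewrite ge0_integral_measure_add//; last 2 first.
  - by move=> l _; rewrite lee_fin sqr_ge0.
  - suff : measurable_fun setT (EFin \o (fun l : R => l ^+ 2)) by [].
    by apply/measurable_EFinP; exact: exprn_measurable.
  have i0 y : (0 <= \int[mu y]_l (l ^+ 2)%:E)%E.
    by apply: integral_ge0 => l _; rewrite lee_fin sqr_ge0.
  move=> h; split; apply: le_lt_trans h; first by rewrite leeDl.
  by rewrite leeDr.
have int x : dom A x -> (mu x).-integrable setT (EFin \o id).
  move=> Ax; apply: integrable_id; first by rewrite muT ltry.
  by move: Ax; rewrite domE.
have formE x : dom A x -> ip (A x) x = (\int[mu x]_l l)%R.
  by move=> Ax; rewrite /redot form.
have cross e x : dom A x -> ip (A (P e x)) (x - P e x) = 0.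
  move=> Ax; have [AP AQ] := domP e x Ax.
  have : ip (A x) x = ip (A (P e x)) (P e x) + ip (A (x - P e x)) (x - P e x).
    rewrite !formE// /Rintegral.
    rewrite (eq_measure_integral (measure_add (mu (P e x)) (mu (x - P e x)))); last first.
      by move=> B mB _; rewrite [RHS]measure_addE; exact: muD.
    have iP := int _ AP; have iQ := int _ AQ.
    rewrite integral_measure_add// fineD//; exact: integrable_fin_num.
  have -> : ip (A x) x =
      ip (A (x - P e x) + A (P e x)) ((x - P e x) + P e x).
    by rewrite -appD// subrK.
  move: (P e x) (x - P e x) AP AQ => p q Ap Aq.
  by rewrite !ipE (sa_sym saA Aq Ap) (ipC _ q (A p)) => *; lra.
(* Apply [cross] to the sum of [P e u] and [v - P e v], which [P e] separates again. *)
have cross2 e u v : dom A u -> dom A v -> ip (A (P e u)) (v - P e v) = 0.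
  move=> Au Av; have [Ap _] := domP e u Au; have [_ Aq] := domP e v Av.
  have := cross e _ (subspaceD (dom_subspace A) Ap Aq).
  by rewrite (islinD (lP e)) PQ0 PP addr0 addrC addKr.
have QP e u : dom A u -> P e (A (P e u)) = A (P e u).
  move=> Au; apply/eqP; rewrite eq_sym -subr_eq0; apply/eqP/ortho_dense => v Av.
  by have := cross2 e u v Au Av; move: (A (P e u)) => w; rewrite !ipE sP.
have PAQ e v : dom A v -> P e (A (v - P e v)) = 0.
  move=> Av; apply: ortho_dense => u Au; rewrite sP.
  have [Ap _] := domP e u Au; have [_ Aq] := domP e v Av.
  by rewrite (sa_sym saA)// ipC cross2.
have muC e x : mu x (~` `]-oo, e]%classic) = (ip x x - ip (P e x) x)%:E.
  have mT : (mu x setT < +oo)%E by rewrite muT ltry.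
  have mI : measurable (`]-oo, e]%classic : set R) by exact: measurable_itv.
  transitivity (mu x setT - mu x `]-oo, e]%classic)%E; last by rewrite muT muE.
  by rewrite -setTD -[in RHS](setTI `]-oo, e]%classic); exact: measureD.
have split_int e x : dom A x -> (\int[mu x]_l l)%R =
    (\int[mu x]_(l in `]-oo, e]%classic) l)%R +
    (\int[mu x]_(l in ~` `]-oo, e]%classic) l)%R.
  move=> Ax; rewrite -Rintegral_setU ?setUv//.
  - exact: measurableC.
  - exact: int.
  - by apply/disj_setPCl.
have null_int (B : set R) x : measurable B -> (mu x).-integrable B (EFin \o id) ->
    mu x B = 0%E -> (\int[mu x]_(l in B) l)%R = 0.
  by move=> mB iB B0; rewrite /Rintegral null_set_integral.
have cst_int (B : set R) x (r : R) : measurable B ->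
    (mu x).-integrable B (EFin \o cst r).
  move=> mB; apply: (integrableS _ _ (@subsetT _ B)) => //.
  apply: measurable_bounded_integrable => //; first by rewrite muT ltry.
  by exists `|r|; split=> [|M hM l _ /=]; [exact: num_real|exact: ltW].
split=> //.
- by move=> e x /(domP e)[].
- move=> e x Ax; have [Ap Aq] := domP e x Ax.
  rewrite -[in RHS](subrK (P e x) x) (appD Aq Ap) (islinD (lP e)) PAQ// add0r.
  by rewrite QP.
(* As [P e x = x], the measure at [x] gives no mass to ]e, +oo[, and [l <= e] on the rest. *)
- move=> e x Ax Px; rewrite formE// (split_int e)// (null_int (~` _)) ?addr0.
  + have -> : e * ip x x = (\int[mu x]_(l in `]-oo, e]%classic) e)%R.
      by rewrite Rintegral_cst// muE Px.
    apply: le_Rintegral; first exact: measurable_itv.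
    * exact: integrableS (int _ Ax).
    * exact: cst_int.
    * by move=> l /=; rewrite in_itv.
  + exact: measurableC.
  + by apply: integrableS (int _ Ax) => //; exact: measurableC.
  + by rewrite muC Px subrr.
- move=> e x Ax Px; rewrite formE// (split_int e)// (null_int `]-oo, e]%classic) ?add0r//.
  + have -> : e * ip x x = (\int[mu x]_(l in ~` `]-oo, e]%classic) e)%R.
      rewrite Rintegral_cst ?muC ?Px ?ip0l ?subr0//; exact: measurableC.
    apply: le_Rintegral; first exact: measurableC.
    * by apply: cst_int; exact: measurableC.
    * by apply: integrableS (int _ Ax) => //; exact: measurableC.
    * by move=> l /=; rewrite in_itv /= => /negP; rewrite -ltNge => /ltW.
  + exact: integrableS (int _ Ax).
  + by rewrite muE Px ip0l.
Qed.

End OfResolution.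

(** * Essential spectrum *)

Section FiniteDimension.
Variables (R : realType) (H : completeNormedModType R[i]).
Implicit Types V W : set H.

Definition independent n (v : 'I_n -> H) :=
  forall c : 'I_n -> R[i], \sum_(i < n) c i *: v i = 0 -> forall i, c i = 0.

Definition has_independent V n :=
  exists2 v : 'I_n -> H, forall i, V (v i) & independent v.

Lemma subspace_sum V n (c : 'I_n -> R[i]) (v : 'I_n -> H) : csubspace V ->
  (forall i, V (v i)) -> V (\sum_(i < n) c i *: v i).
Proof.
move=> sV vV; apply: (big_ind V); first exact: subspace0.
  by move=> x y; exact: subspaceD.
by move=> i _; exact: subspaceZ.
Qed.

Lemma independent_extend V n (v : 'I_n -> H) x :
  (forall i, V (v i)) -> independent v -> V x ->
  (forall c : 'I_n -> R[i], x <> \sum_(i < n) c i *: v i) ->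
  has_independent V n.+1.
Proof.
move=> vV iv Vx xv.
exists (fun i => if unlift ord0 i is Some j then v j else x).
  by move=> i; case: unliftP.
move=> c; rewrite big_ord_recl unlift_none.
under eq_bigr do rewrite liftK.
have [c0|c0] := eqVneq (c ord0) 0.
  rewrite c0 scale0r add0r => h i.
  case: (unliftP ord0 i) => [j ->|-> //].
  exact: (iv (fun j => c (lift ord0 j)) h j).
move=> h; exfalso; apply: (xv (fun j => - (c (lift ord0 j) / c ord0))).
have := congr1 (fun y => (c ord0)^-1 *: y) h.
rewrite scalerDr scalerA mulVf// scale1r scaler0 => /eqP; rewrite addr_eq0 => /eqP ->.
rewrite scaler_sumr -sumrN; apply: eq_bigr => i _.
by rewrite scalerA mulrC scaleNr.
Qed.

Lemma infinite_independent V n : ~ finite_dimensional V -> has_independent V n.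
Proof.
move=> infV; elim: n => [|n [v vV iv]].
  by exists (fun=> 0) => [[]//|c _ []].
have [x [Vx xv]] : exists x, V x /\ forall c : 'I_n -> R[i], x <> \sum_(i < n) c i *: v i.
  apply: contrapT => h; apply: infV; exists n, v => x Vx; apply: contrapT => hx.
  by apply: h; exists x; split=> // c e; apply: hx; exists c.
exact: independent_extend iv Vx xv.
Qed.

Lemma finite_not_independent V : finite_dimensional V ->
  exists n, ~ has_independent V n.
Proof.
move=> [n [e Ve]]; exists n.+1 => -[v vV iv].
have /choice[M hM] i : exists c : 'I_n -> R[i], v i = \sum_(j < n) c j *: e j.
  exact: Ve.
pose N : 'M[R[i]]_(n.+1, n) := \matrix_(i, j) M i j.
have : kermx N != 0.
  rewrite -mxrank_eq0 mxrank_ker subn_eq0 -ltnNge ltnS.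
  exact: rank_leq_col.
case/rowV0Pn => c /sub_kermxP cN c0; case/eqP: c0.
apply/rowP => i; rewrite mxE; apply: (iv (fun i => c 0 i)).
under eq_bigr do rewrite hM scaler_sumr.
rewrite exchange_big big1//= => j _.
under eq_bigr do rewrite scalerA.
rewrite -scaler_suml; have := congr1 (fun u : 'rV_n => u 0 j) cN.
rewrite !mxE; under eq_bigr do rewrite mxE.
by move=> ->; rewrite scale0r.
Qed.

(** Enough independent vectors have dependent images in [W], and a relation between these gives a
    kernel vector. In use, [T] projects to a finite-dimensional band, so some vector of [V] has no
    component there. *)
Lemma infinite_kernel V W (T : H -> H) : csubspace V -> islin T ->
  ~ finite_dimensional V -> finite_dimensional W -> (forall x, V x -> W (T x)) ->
  exists x, [/\ V x, x <> 0 & T x = 0].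
Proof.
move=> sV lT infV /finite_not_independent[n nW] VW.
have [v vV iv] := infinite_independent n infV.
have [c [cT [i ci]]] : exists c : 'I_n -> R[i],
    \sum_(i < n) c i *: T (v i) = 0 /\ exists i, c i <> 0.
  apply: contrapT => h; apply: nW; exists (T \o v) => [i|c cT i].
    exact/VW/vV.
  by apply: contrapT => ci; apply: h; exists c; split=> //; exists i.
exists (\sum_(i < n) c i *: v i); split.
- exact: subspace_sum.
- by move=> /iv /(_ i).
- rewrite -[RHS]cT; apply: (big_ind2 (fun x y => T x = y)).
  + exact: islin0.
  + by move=> x _ y _ <- <-; rewrite islinD.
  + by move=> j _; rewrite islinZ.
Qed.

Lemma finite_dimensional_sub V W : V `<=` W -> finite_dimensional W ->
  finite_dimensional V.
Proof. by move=> VW [n [e We]]; exists n, e => x /VW; exact: We. Qed.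

Lemma finite_dimensional_add V V1 V2 : finite_dimensional V1 ->
  finite_dimensional V2 ->
  (forall x, V x -> exists y z, [/\ V1 y, V2 z & x = y + z]) ->
  finite_dimensional V.
Proof.
move=> [m [e He]] [n [f Hf]] VV.
exists (m + n)%N, (fun i => match fintype.split i with inl j => e j | inr k => f k end).
move=> x /VV[y [z [/He[c ->] /Hf[d ->] ->]]].
exists (fun i => match fintype.split i with inl j => c j | inr k => d k end).
rewrite big_split_ord /=; congr (_ + _); apply: eq_bigr => i _.
  by rewrite (unsplitK (inl _ i)).
by rewrite (unsplitK (inr _ i)).
Qed.

End FiniteDimension.

(** Connectedness of [a, b], through the supremum of the points where [g] still has its value at
    [a]; it will be used for [P] on stretches free of spectrum. *)
Lemma locally_constant (R : realType) (T : Type) (g : R -> T) (a b : R) : a <= b ->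
  (forall t, a <= t <= b -> exists2 eta, 0 < eta & forall s s',
     t - eta < s -> s <= s' -> s' < t + eta -> g s = g s') ->
  g a = g b.
Proof.
move=> ab h.
pose S := [set t | a <= t <= b /\ g t = g a].
have Sa : S a by split=> //; rewrite lexx ab.
have hS : has_sup S by split; [exists a|exists b => t [/andP[]]].
have aT : a <= sup S by exact: (sup_upper_bound hS).
have Tb : sup S <= b by apply: ge_sup; [exists a|move=> t [/andP[]]].
have [eta eta0 hT] := h (sup S) (introT andP (conj aT Tb)).
have [t [tab gt] tT] := sup_adherent eta0 hS.
have tS : t <= sup S by exact: (sup_upper_bound hS).
have [bT|bT] := leP b (sup S).
  by rewrite -gt; apply: hT => //; [case/andP: tab|lra].
pose T' := Num.min b (sup S + eta / 2).
have : T' <= sup S.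
  apply: (sup_upper_bound hS); split.
    by rewrite ge_min lexx /= le_min ab /=; lra.
  rewrite -gt; apply/esym/hT => //; first by rewrite le_min; apply/andP; split; lra.
  by rewrite gt_min; apply/orP; right; lra.
by rewrite ge_min => /orP[|] ?; exfalso; lra.
Qed.

(** * Essential spectrum read off from the dimensions of bands *)

Section EssentialSpectrum.
Variables (R : realType) (H : completeNormedModType R[i]).
Variables (dot : {dot H for Num.conj}) (dot_norm : induces_norm dot).
Local Notation ip := (redot dot).
Variables (A : operator H) (saA : self_adjoint dot A).
Variables (P : R -> H -> H) (sfP : spectral_family dot A P).

Definition band_range c d := [set y | P d y = y /\ P c y = 0].

Lemma band_range_subspace c d : csubspace (band_range c d).
Proof.
split; first by rewrite /band_range /= !(islin0 (sf_lin sfP _)).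
by move=> k x y [dx cx] [dy cy]; rewrite /band_range /= !(sf_lin sfP) dx dy cx cy
  scaler0 addr0.
Qed.

Lemma band_rangeS c c' d' d : c <= c' -> d' <= d ->
  band_range c' d' `<=` band_range c d.
Proof.
move=> cc' dd' x [d'x c'x]; split; first by rewrite -d'x (sf_mono sfP).
by rewrite -(sf_monor dot_norm sfP x cc') c'x (islin0 (sf_lin sfP _)).
Qed.

Lemma band_in c d x : c <= d -> band_range c d (band P c d x).
Proof.
by move=> cd; split; [exact: (band_upper sfP)|exact: (band_lower dot_norm sfP)].
Qed.

Lemma finite_band_cat c t d : c <= t -> t <= d ->
  finite_dimensional (band_range c t) -> finite_dimensional (band_range t d) ->
  finite_dimensional (band_range c d).
Proof.
move=> ct td f1 f2; apply: (finite_dimensional_add f1 f2) => x [dx cx].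
exists (band P c t x), (band P t d x); split; [exact: band_in|exact: band_in|].
by rewrite -band_cat (band_fix dx cx).
Qed.

Lemma finite_bandS c c' d' d : c <= c' -> d' <= d ->
  finite_dimensional (band_range c d) -> finite_dimensional (band_range c' d').
Proof. by move=> cc' dd'; apply: finite_dimensional_sub; exact: band_rangeS. Qed.

Lemma band_range_dom c d x : c <= d -> band_range c d x -> dom A x.
Proof. by move=> cd [dx cx]; exact: (dom_band dot_norm saA sfP cd). Qed.

Lemma band_range_bound l e x : 0 <= e -> band_range (l - e) (l + e) x ->
  nm (A x - l%:C *: x) <= e * nm x.
Proof.
move=> e0 [dx cx].
have := band_bound dot_norm saA sfP _ dx cx.
have -> : (l - e + (l + e)) / 2 = l by field.
have -> : (l + e - (l - e)) / 2 = e by field.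
by apply; lra.
Qed.

(** The vector is a sum of a part where [A <= m - r] and a part where [A >= m + r]. Cauchy-Schwarz
    gives the bound on each part; the parts and their images under [A] are mutually orthogonal. *)
Lemma gap_bound (c d m r : R) x : 0 <= r -> c <= m - r -> m + r <= d -> dom A x ->
  band P c d x = 0 -> r * nm x <= nm (A x - m%:C *: x).
Proof.
move=> r0 cm md Ax bx.
have Pdc : P d x = P c x by apply/eqP; rewrite -subr_eq0; apply/eqP.
have Ap : dom A (P c x) by exact: (sf_dom sfP).
have Aq : dom A (x - P c x) by exact: (subspaceB (dom_subspace A)).
have Pp : P c (P c x) = P c x by rewrite (sf_idem sfP).
have Pq : P c (x - P c x) = 0 by rewrite (islinB (sf_lin sfP c)) Pp subrr.
have Pdq : P d (x - P c x) = 0.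
  by rewrite (islinB (sf_lin sfP d)) (sf_mono sfP) ?Pdc ?subrr//; lra.
have xE : x = (x - P c x) + P c x by rewrite subrK.
move: (P c x) (x - P c x) Ap Aq Pp Pq Pdq xE => p q Ap Aq Pp Pq Pdq xE.
have PAp : P c (A p) = A p by rewrite -(sf_comm sfP)// Pp.
have PAq : P c (A q) = 0 by rewrite -(sf_comm sfP)// Pq app0.
have pq : ip p q = 0 by rewrite -Pp (sf_sym sfP) Pq ip0r.
have Apq : ip (A p) q = 0 by rewrite -PAp (sf_sym sfP) Pq ip0r.
have pAq : ip p (A q) = 0 by rewrite -Pp (sf_sym sfP) PAq ip0r.
have AA : ip (A p) (A q) = 0 by rewrite -PAp (sf_sym sfP) PAq ip0r.
have hp : (r * nm p) ^+ 2 <= nm (A p - m%:C *: p) ^+ 2.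
  have := sf_le sfP Ap Pp.
  have := cauchy_schwarz dot_norm (- (A p - m%:C *: p)) p.
  rewrite nmN ler_sqr ?nnegrE ?mulr_ge0 ?nm_ge0// => h1 h2.
  have [p0|p0] := eqVneq (nm p) 0; first by rewrite p0 mulr0 nm_ge0.
  have p1 : 0 < nm p by rewrite lt_neqAle eq_sym p0 nm_ge0.
  rewrite -(ler_pM2r p1); apply: le_trans h1.
  move: h2; rewrite !ipE -!(nm2 dot_norm); nra.
have hq : (r * nm q) ^+ 2 <= nm (A q - m%:C *: q) ^+ 2.
  have := sf_ge sfP Aq Pdq.
  have := cauchy_schwarz dot_norm (A q - m%:C *: q) q.
  rewrite ler_sqr ?nnegrE ?mulr_ge0 ?nm_ge0// => h1 h2.
  have [p0|p0] := eqVneq (nm q) 0; first by rewrite p0 mulr0 nm_ge0.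
  have p1 : 0 < nm q by rewrite lt_neqAle eq_sym p0 nm_ge0.
  rewrite -(ler_pM2r p1); apply: le_trans h1.
  move: h2; rewrite !ipE -!(nm2 dot_norm); nra.
rewrite -ler_sqr ?nnegrE ?mulr_ge0 ?nm_ge0//.
move: hp hq; rewrite xE appD// !exprMn !(nm2 dot_norm) !ipE.
rewrite (ipC _ q p) pq (ipC _ (A q) (A p)) AA (ipC _ (A q) p) pAq (ipC _ q (A p)) Apq.
by rewrite (ipC _ p (A p)) (ipC _ q (A q)) => *; lra.
Qed.

(** This replaces the definition through isolated eigenvalues; the equivalence is [ess_pointP]. *)
Definition ess_point l := forall c d, c < l -> l < d ->
  ~ finite_dimensional (band_range c d).

(* No band around [m - r, m + r] is finite dimensional, since [A - m] would be
   too large on the vectors of [V] killed by its projection; bisection is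
   replaced by a supremum. *)
Lemma ess_point_of_subspace V m r : csubspace V -> V `<=` dom A ->
  ~ finite_dimensional V ->
  (forall x, V x -> nm (A x - m%:C *: x) <= r * nm x) -> 0 <= r ->
  exists l, [/\ m - r <= l, l <= m + r & ess_point l].
Proof.
move=> sV VA infV Vr r0.
have big c d : c < m - r -> m + r < d -> ~ finite_dimensional (band_range c d).
  move=> cm md fin; pose s := Num.min (m - c) (d - m).
  have rs : r < s by rewrite lt_min; apply/andP; split; lra.
  have sc : s <= m - c by rewrite ge_min lexx.
  have sd : s <= d - m by rewrite ge_min lexx orbT.
  have cd : c <= d by lra.
  have [x [Vx x0 bx]] := infinite_kernel sV (band_lin sfP c d) infV fin
    (fun x _ => band_in x cd).
  have h := Vr _ Vx; apply: x0; apply: nm_eq0; apply/eqP.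
  rewrite eq_le nm_ge0 andbT.
  have := @gap_bound c d m s x _ _ _ (VA _ Vx) bx.
  move=> /(_ (ltW (le_lt_trans r0 rs))); have -> : c <= m - s by lra.
  have -> : m + s <= d by lra.
  move=> /(_ isT isT) h2; have := nm_ge0 x; nra.
apply: contrapT => noess.
have fin l : m - r <= l -> l <= m + r -> exists c d,
    [/\ c < l, l < d & finite_dimensional (band_range c d)].
  move=> h1 h2; apply: contrapT => h; apply: noess; exists l; split=> // c d cl ld f.
  by apply: h; exists c, d.
(* Right ends of finite-dimensional bands starting below [m - r]. Without an essential point, a
   finite band around [sup S] could be glued to one ending just before it, giving an element of [S]
   beyond the supremum. *)
pose S := [set t | exists c, [/\ c < m - r, c <= t & finite_dimensional (band_range c t)]].
have ubS : ubound S (m + r).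
  move=> t [c [cm ct f]]; rewrite leNgt; apply/negP => tm.
  exact: big cm tm f.
have [c1 [d1 [c1m md1 f1]]] : exists c d, [/\ c < m - r, m - r < d &
    finite_dimensional (band_range c d)] by apply: fin; lra.
have Sd1 : S d1 by exists c1; split=> //; lra.
have hS : has_sup S by split; [exists d1|exists (m + r)].
have d1T : d1 <= sup S by exact: (sup_upper_bound hS).
have Tm : sup S <= m + r by apply: ge_sup => //; exists d1.
have [c [d [cT Td f]]] : exists c d, [/\ c < sup S, sup S < d &
    finite_dimensional (band_range c d)] by apply: fin; lra.
have e0 : 0 < sup S - c by rewrite subr_gt0.
have [t St tT] := sup_adherent e0 hS.
have tS : t <= sup S by exact: (sup_upper_bound hS).
have [c0 [c0m c0t f0]] := St.
have : S d.
  exists c0; split=> //; first lra.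
  apply: (finite_band_cat c0t _ f0); first lra.
  by apply: finite_bandS f => //; lra.
by move/(sup_upper_bound hS); lra.
Qed.

Lemma ess_point_closed l : (forall e, 0 < e -> exists2 l', ess_point l' & `|l' - l| < e) ->
  ess_point l.
Proof.
move=> h c d cl ld f.
have e0 : 0 < Num.min (l - c) (d - l) by rewrite lt_min; apply/andP; split; lra.
have [l' el' ll'] := h _ e0.
move: ll'; rewrite lt_min !ltr_norml => /andP[/andP[h1 h2] /andP[h3 h4]].
by apply: (el' c d) f; lra.
Qed.

Lemma nonreal_resolvent (z : R[i]) : complex.Im z != 0 -> resolvent_set A z.
Proof.
move=> z0; apply: (resolvent_criterion dot_norm saA (c := `|complex.Im z|)).
  by rewrite normr_gt0.
by move=> x Ax; rewrite exprMn -normrX ger0_norm ?sqr_ge0// lerDr sqr_ge0.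
Qed.

Lemma gap_resolvent mu eta : 0 < eta ->
  (forall x, band_range (mu - eta) (mu + eta) x -> x = 0) -> resolvent_set A mu%:C.
Proof.
move=> eta0 h; apply: (resolvent_criterion dot_norm saA eta0) => x Ax /=.
rewrite expr0n /= mul0r addr0 ler_sqr ?nnegrE ?mulr_ge0 ?nm_ge0 ?(ltW eta0)//.
apply: (@gap_bound (mu - eta) (mu + eta)) => //; first exact: ltW.
by apply/h/band_in; lra.
Qed.

Lemma resolvent_gap mu : resolvent_set A mu%:C -> exists2 eta, 0 < eta &
  forall x, band_range (mu - eta) (mu + eta) x -> x = 0.
Proof.
move=> /resolvent_bound[c c0 hc]; exists (c / 2); first by rewrite divr_gt0.
move=> x bx; have c2 : 0 <= c / 2 by rewrite divr_ge0// ltW.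
have h := band_range_bound c2 bx.
have Ax : dom A x by apply: band_range_dom bx; lra.
have := hc _ Ax => h2; apply: nm_eq0; apply/eqP; rewrite eq_le nm_ge0 andbT.
have := nm_ge0 x; nra.
Qed.

Lemma small_bands_eigen l d x : 0 < d ->
  (forall e, 0 < e -> e < d -> band_range (l - e) (l + e) x) ->
  operator_eigenspace A l%:C x.
Proof.
move=> d0 h.
have d2 : 0 < d / 2 by rewrite divr_gt0.
split; first by apply: band_range_dom (h (d / 2) d2 _); lra.
apply/eqP; rewrite -subr_eq0; apply/eqP/nm_eq0/eqP; rewrite eq_le nm_ge0 andbT.
apply: (@le0_harmonic _ _ (d / 2 * nm x)) => n.
rewrite mulrAC; apply: band_range_bound; first by rewrite mulr_ge0 ?invr_ge0// ltW.
apply: h; first by rewrite mulr_gt0 ?invr_gt0.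
apply: (@le_lt_trans _ _ (d / 2)); last by lra.
by rewrite ger_pMr// invf_le1// ler1n.
Qed.

Lemma eigen_band_range l c d x : c < l -> l < d ->
  operator_eigenspace A l%:C x -> band_range c d x.
Proof.
move=> cl ld [Ax Axl].
have h e : A (P e x) = l%:C *: P e x.
  by rewrite (sf_comm sfP)// Axl (islinZ (sf_lin sfP e)).
split.
- have AQ : dom A (x - P d x).
    by apply: (subspaceB (dom_subspace A)) => //; exact: (sf_dom sfP).
  have PQ : P d (x - P d x) = 0.
    by rewrite (islinB (sf_lin sfP d)) (sf_idem sfP) subrr.
  have := sf_ge sfP AQ PQ; rewrite appB//; last exact: (sf_dom sfP).
  rewrite h Axl -scalerBr ipZl => le; apply/eqP; rewrite eq_sym -subr_eq0.
  apply/eqP/(ip_eq0 dot_norm); have := ip_ge0 dot_norm (x - P d x); nra.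
- have := sf_le sfP (sf_dom sfP c Ax) (sf_idem sfP c x).
  rewrite h ipZl => le; apply: (ip_eq0 dot_norm).
  by have := ip_ge0 dot_norm (P c x); nra.
Qed.

(** Some [x] of the band that is not an eigenvector drops out of a smaller band, which then has
    fewer independent vectors; the induction on their number ends at a band of eigenvectors. *)
Lemma finite_band_eigen n l d : 0 < d ->
  ~ has_independent (band_range (l - d) (l + d)) n ->
  exists e, [/\ 0 < e, e <= d &
    band_range (l - e) (l + e) `<=` operator_eigenspace A l%:C].
Proof.
elim: n d => [|n ih] d d0 nind.
  by exfalso; apply: nind; exists (fun=> 0) => [[]//|c _ []].
have [sub|] := pselect (band_range (l - d) (l + d) `<=` operator_eigenspace A l%:C).
  by exists d.
move=> /existsNP[x /not_implyP[bx nx]].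
have [e [e0 ed nbx]] : exists e, [/\ 0 < e, e < d & ~ band_range (l - e) (l + e) x].
  apply: contrapT => h; apply: nx; apply: (small_bands_eigen d0) => e e0 ed.
  by apply: contrapT => nb; apply: h; exists e.
have sub : band_range (l - e) (l + e) `<=` band_range (l - d) (l + d).
  by apply: band_rangeS; lra.
have [|e' [e'0 e'e h]] := ih e e0.
  move=> [v vV iv]; apply: nind.
  apply: (independent_extend (v := v) (x := x)) => // [i|c xe].
    exact/sub/vV.
  by apply: nbx; rewrite xe; apply: subspace_sum => //; exact: band_range_subspace.
by exists e'; split=> //; lra.
Qed.

Lemma ess_pointP l : essential_spectrum A l%:C <-> ess_point l.
Proof.
split=> [[spec ndisc] c d cl ld fin|ess].
- apply: ndisc.
  pose r := Num.min (l - c) (d - l).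
  have r0 : 0 < r by rewrite lt_min; apply/andP; split; lra.
  have rc : r <= l - c by rewrite ge_min lexx.
  have rd : r <= d - l by rewrite ge_min lexx orbT.
  have {}fin' : finite_dimensional (band_range (l - r) (l + r)).
    by apply: finite_bandS fin; lra.
  have [n nind] := finite_not_independent fin'.
  have [e [e0 er he]] := finite_band_eigen r0 nind.
  (* The band of half-width [eta] around [mu] consists of eigenvectors at [l], but
     [eta <= |mu - l| / 2] is too small for that eigenvalue, so the band is trivial. *)
  have res mu : 0 < `|mu - l| -> `|mu - l| < e -> resolvent_set A mu%:C.
    move=> h1 h2.
    pose eta := Num.min (`|mu - l| / 2) (e - `|mu - l|).
    have eta0 : 0 < eta by rewrite lt_min divr_gt0// subr_gt0.
    have etal : eta <= `|mu - l| / 2 by rewrite ge_min lexx.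
    have etae : eta <= e - `|mu - l| by rewrite ge_min lexx orbT.
    apply: (gap_resolvent eta0) => x bx.
    have [mul1 mul2] : - `|mu - l| <= mu - l /\ mu - l <= `|mu - l|.
      by apply/andP; rewrite -ler_norml.
    have [Ax Axl] : operator_eigenspace A l%:C x.
      by apply: he; apply: band_rangeS bx; lra.
    have := band_range_bound (ltW eta0) bx.
    rewrite Axl -scalerBl -rmorphB nmZ distrC => h3; apply: nm_eq0; apply/eqP.
    rewrite eq_le nm_ge0 andbT; have := nm_ge0 x; nra.
  split.
  + split; first exact/mem_set.
    exists (ball (l%:C : R[i]^o) e%:C); first by apply: nbhsx_ballx; rewrite ltcR.
    apply/seteqP; split=> [z [zl zs]|_ -> /=]; last first.
      by split=> //; apply: ballxx; rewrite ltcR.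
    apply: contrapT => zl'; apply: zs.
    have [im0|im0] := eqVneq (complex.Im z) 0; last exact: nonreal_resolvent.
    have zE : z = (complex.Re z)%:C by case: (z) im0 => a b /= ->.
    rewrite zE; apply: res.
      rewrite normr_gt0 subr_eq0; apply/eqP => h; apply: zl'.
      by rewrite /= zE h.
    move: zl; rewrite -ball_normE /= zE -rmorphB normc_def /= expr0n /= addr0.
    by rewrite sqrtr_sqr ltcR distrC.
  + apply: contrapT => h; apply: spec; apply: (gap_resolvent e0) => x bx.
    apply: contrapT => x0; apply: h; exists x; first exact: he.
    exact/eqP.
  + apply: finite_dimensional_sub fin => x; exact: eigen_band_range.
- split.
  + move=> /resolvent_gap[eta eta0 h]; apply: (ess (l - eta) (l + eta)); [lra|lra|].
    exists 0%N, (fun=> 0) => x /h ->; exists (fun=> 0).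
    by rewrite big_ord0.
  + move=> [[_ [V Vl VS]] _ fin].
    have [e e0 eV] : exists2 e : R, 0 < e & forall mu, `|mu - l| < e -> V mu%:C.
      move: Vl; rewrite -nbhs_ballE => -[d d0 dV].
      exists (complex.Re d).
        by move: d0 => /=; case: (d) => a b; rewrite ltcE /= => /andP[].
      move=> mu mul; apply: dV; rewrite -ball_normE /= -rmorphB normc_def /= expr0n /=.
      by rewrite addr0 sqrtr_sqr distrC -(RRe_real (gtr0_real d0)) ltcR.
    have res mu : `|mu - l| < e -> mu != l -> resolvent_set A mu%:C.
      move=> mul nmu; apply: contrapT => ns.
      have : (V `&` spectrum A) mu%:C by split=> //; exact: eV.
      by rewrite VS => /complexI; exact/eqP.
    clear V Vl VS eV.
    (* On either side of the isolated point [l] the projections are locally constant in the energy,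
       so a small band around [l] is unchanged by shrinking and consists of eigenvectors. *)
    have const s t x : s <= t -> `|s - l| < e -> `|t - l| < e ->
        (t < l \/ l < s) -> P s x = P t x.
      move=> st sl tl side; apply: (@locally_constant _ _ (fun e => P e x)) => // m /andP[sm mt].
      have [eta eta0 h] : exists2 eta, 0 < eta &
          forall x, band_range (m - eta) (m + eta) x -> x = 0.
        apply/resolvent_gap/res.
          move: sl tl; rewrite !ltr_norml => /andP[? ?] /andP[? ?].
          by apply/andP; split; lra.
        by apply/eqP => ml; case: side => ?; lra.
      exists eta => // u v mu uv vm; apply/eqP; rewrite eq_sym -subr_eq0; apply/eqP/h.
      by apply: band_rangeS (band_in x uv); lra.
    have e2 : 0 < e / 2 by rewrite divr_gt0.
    apply: (ess (l - e / 2) (l + e / 2)); [lra|lra|].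
    apply: finite_dimensional_sub fin => x [ux lx].
    apply: (small_bands_eigen e2) => r r0 re; split.
      rewrite -[RHS]ux; apply: const; [lra| | |by right; lra];
        by rewrite ltr_norml; apply/andP; split; lra.
    rewrite -[RHS]lx; apply/esym; apply: const; [lra| | |by left; lra];
      by rewrite ltr_norml; apply/andP; split; lra.
Qed.

End EssentialSpectrum.

(** * Weyl's criterion with infinite-dimensional subspaces *)

Section Weyl.
Variables (R : realType) (H : completeNormedModType R[i]).
Variables (dot : {dot H for Num.conj}) (dot_norm : induces_norm dot).
Local Notation ip := (redot dot).

Lemma spectral_projection_family (S : operator H) : self_adjoint dot S ->
  spectral_family dot S (spectral_projection dot S).
Proof.
move=> saS; apply: spectral_family_of_resolution => //.
have [P rP] := resolution_of_identity_exists dot_norm saS.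
exact: (getPex (ex_intro _ P rP)).
Qed.

(** The band of radius [e] around [l] serves as [V]; [l + e <= b] places it in the range where the
    lower bound on [B] is assumed. *)
Lemma weyl_subspace (S : operator H) l e b : self_adjoint dot S ->
  essential_spectrum S l%:C -> 0 < e -> l + e <= b ->
  exists V, [/\ csubspace V, ~ finite_dimensional V &
    forall x, V x -> [/\ dom S x, nm (S x - l%:C *: x) <= e * nm x &
      range (spectral_projection dot S b) x]].
Proof.
move=> saS ess e0 leb; have sfS := spectral_projection_family saS.
exists (band_range (spectral_projection dot S) (l - e) (l + e)); split.
- exact: (band_range_subspace sfS).
- by move/(ess_pointP dot_norm saS sfS) : ess; apply; lra.
- move=> x Vx; split.
  + by apply: (band_range_dom dot_norm saS sfS _ Vx); lra.
  + exact: (band_range_bound dot_norm saS sfS (ltW e0)).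
  + by exists x => //; case: Vx => <- _; rewrite (sf_mono sfS).
Qed.

Lemma essential_of_subspace (S : operator H) V m r : self_adjoint dot S ->
  csubspace V -> ~ finite_dimensional V -> 0 <= r ->
  (forall x, V x -> dom S x /\ nm (S x - m%:C *: x) <= r * nm x) ->
  exists l, [/\ m - r <= l, l <= m + r & essential_spectrum S l%:C].
Proof.
move=> saS sV infV r0 hV; have sfS := spectral_projection_family saS.
have [||l [h1 h2 h3]] := ess_point_of_subspace dot_norm sfS sV _ infV _ r0 (m := m).
- by move=> x /hV[].
- by move=> x /hV[].
by exists l; split=> //; exact/(ess_pointP dot_norm saS sfS).
Qed.

Lemma essential_closed (S : operator H) l : self_adjoint dot S ->
  (forall e : R, 0 < e -> exists2 l', essential_spectrum S l'%:C & `|l' - l| < e) ->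
  essential_spectrum S l%:C.
Proof.
move=> saS h; have sfS := spectral_projection_family saS.
apply/(ess_pointP dot_norm saS sfS)/ess_point_closed => e e0.
by have [l' /(ess_pointP dot_norm saS sfS) h1 h2] := h e e0; exists l'.
Qed.

(* Stated for operators that agree pointwise, so that no equality between the
   proofs packed in [operator] is needed. *)
Lemma essential_eq (S T : operator H) l : self_adjoint dot S ->
  self_adjoint dot T -> dom S `<=` dom T -> (forall x, S x = T x) ->
  essential_spectrum S l%:C -> essential_spectrum T l%:C.
Proof.
move=> saS saT ST STE ess; apply: essential_closed => // e e0.
have e2 : 0 < e / 2 by rewrite divr_gt0.
have [V [sV infV hV]] := weyl_subspace saS ess e2 (lexx _).
have [|l' [h1 h2 h3]] := essential_of_subspace saT sV infV (ltW e2) (m := l).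
  by move=> x /hV[/ST Tx h _]; rewrite -STE.
by exists l' => //; rewrite ltr_norml; apply/andP; split; lra.
Qed.

Lemma operator_norm_bound (B : {linear H -> H}) x : bounded_operator B ->
  nm (B x) <= operator_norm B * nm x.
Proof.
move=> /bounded_operatorP[M M0 bB].
have [->|x0] := eqVneq x 0; first by rewrite linear0 nm0 mulr0.
have nx : 0 < nm x.
  by rewrite lt_neqAle nm_ge0 andbT eq_sym; apply: contra_neq x0 => /nm_eq0.
rewrite -ler_pdivrMr// mulrC.
have -> : (nm x)^-1 * nm (B x) = complex.Re `|B ((nm x)^-1%:C *: x)|.
  by rewrite linearZ /= -/(nm _) nmZ gtr0_norm// invr_gt0.
apply: sup_upper_bound.
  split; first by exists (complex.Re `|B 0|), 0 => //=; rewrite normr0.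
  exists M => _ [y /= y1 <-]; rewrite -/(nm _); apply: le_trans (bB y) _.
  by rewrite ger_pMr// -(lecR (nm y) 1) -normE.
exists ((nm x)^-1%:C *: x) => //=.
by rewrite normE nmZ gtr0_norm ?invr_gt0// mulVf// gt_eqF.
Qed.

End Weyl.

(** * Perturbation *)

Section Perturbation.
Variables (R : realType) (H : completeNormedModType R[i]).
Variables (dot : {dot H for Num.conj}) (dot_norm : induces_norm dot).
Local Notation ip := (redot dot).
Variables (A : operator H) (A_self_adjoint : self_adjoint dot A).
Variables (B : {linear H -> H}) (B_bounded : bounded_operator B).
Hypothesis B_symmetric : symmetric_operator dot B.
Hypothesis B_ge0 : nonnegative_operator dot B.

Local Notation beta := (operator_norm B).
Local Notation At t := (op_add A (t%:C \*: B)).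

Lemma bounded_nm x : nm (B x) <= beta * nm x.
Proof. exact: operator_norm_bound. Qed.

Lemma operator_norm_ge0 : 0 <= beta.
Proof.
have [x0|/existsNP[x x0]] := pselect (forall x, B x = 0).
  rewrite /operator_norm; set S := [set _ | _ in _].
  have -> : S = [set 0].
    apply/seteqP; split=> [_ [x _ <-]|_ ->]; first by rewrite x0 normr0.
    by exists 0; rewrite /= ?normr0// ?x0 ?normr0.
  by rewrite sup1.
have bx : 0 < nm (B x) by rewrite lt_neqAle nm_ge0 andbT eq_sym; apply/eqP => /nm_eq0.
have xx : 0 < nm x.
  rewrite lt_neqAle nm_ge0 andbT eq_sym; apply/eqP => /nm_eq0 x1.
  by apply: x0; rewrite x1 linear0.
have := lt_le_trans bx (bounded_nm x).
by rewrite pmulr_lgt0// => /ltW.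
Qed.

Lemma ipB_ge0 x : 0 <= ip x (B x).
Proof. by have := B_ge0 x; rewrite lecE => /andP[_]. Qed.

Lemma ipB_sym x y : ip (B x) y = ip x (B y).
Proof. by rewrite /redot B_symmetric. Qed.

(** This is [B^2 <= beta B], which puts [B] within [beta / 2] of the scalar [beta / 2]. The case
    [beta = 0] is separate because [positive_cauchy_schwarz] asks for a positive constant. *)
Lemma bounded_sq x : nm (B x) ^+ 2 <= beta * ip x (B x).
Proof.
have := operator_norm_ge0; rewrite le_eqVlt => /predU1P[b0|b0].
  have := bounded_nm x; rewrite -b0 !mul0r => h.
  have -> : nm (B x) = 0 by apply/eqP; rewrite eq_le h nm_ge0.
  by rewrite expr0n.
rewrite -ipB_sym; apply: (positive_cauchy_schwarz dot_norm) => //.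
- exact: islin_linear.
- exact: ipB_sym.
- by move=> y; rewrite ipC; exact: ipB_ge0.
- exact: bounded_nm.
Qed.

Lemma At_self_adjoint t : self_adjoint dot (At t).
Proof.
apply: self_adjoint_add => //; apply/symmetric_operatorP => [|x y].
  exact: islin_linear.
by rewrite /= ipZl ipZr ipB_sym.
Qed.

Variables a b : R.
Hypothesis gap : [set l%:C | l in `]a, b[] `&` essential_spectrum A = set0.
Hypothesis B_small : beta < b - a.

(* [A + t B] is within [t beta / 2] of [A + t beta / 2], as [0 <= B <= beta]. *)
Lemma essential_upper t l : 0 <= t -> l < b -> essential_spectrum (At t) l%:C ->
  l <= a + t * beta.
Proof.
move=> t0 lb ess; rewrite leNgt; apply/negP => al.
(* The point [l'] found for [A] will lie between [l - t beta - e] and [l + e]; this [e] keeps both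
   strictly inside ]a, b[, against the gap. *)
pose e := Num.min (l - a - t * beta) (b - l) / 2.
have e1 : e <= (l - a - t * beta) / 2 by rewrite ler_pM2r ?invr_gt0// ge_min lexx.
have e2 : e <= (b - l) / 2 by rewrite ler_pM2r ?invr_gt0// ge_min lexx orbT.
have e0 : 0 < e by rewrite divr_gt0// lt_min; apply/andP; split; lra.
have tb : 0 <= t * beta by rewrite mulr_ge0// operator_norm_ge0.
have lee : l + e <= l + e by [].
have [V [sV infV hV]] := weyl_subspace dot_norm (At_self_adjoint t) ess e0 lee.
have r0 : 0 <= e + t * (beta / 2) by lra.
have [|l' [l1 l2 essl']] := essential_of_subspace dot_norm A_self_adjoint sV infV
    (m := l - t * (beta / 2)) r0.
  move=> x /hV[Ax hx _]; split=> //.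
  have hB : nm (B x - (beta / 2)%:C *: x) <= beta / 2 * nm x.
    rewrite -ler_sqr ?nnegrE ?nm_ge0 ?mulr_ge0 ?nm_ge0 ?divr_ge0 ?operator_norm_ge0//.
    have := bounded_sq x; rewrite exprMn !(nm2 dot_norm) !ipE (ipC _ (B x) x).
    by move=> *; nra.
  have -> : A x - (l - t * (beta / 2))%:C *: x =
      (At t x - l%:C *: x) - t%:C *: (B x - (beta / 2)%:C *: x).
    rewrite /= scalerBr scalerA -rmorphM rmorphB scalerBl !opprB.
    rewrite (addrAC (A x)) [RHS]addrACA subrr addr0.
    by rewrite [_ *: _ - _]addrC addrA.
  apply: le_trans (nmD _ _) _; rewrite nmN nmZ ger0_norm// mulrDl.
  apply: lerD; first exact: hx.
  by rewrite -mulrA ler_wpM2l.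
have : ([set l%:C | l in `]a, b[] `&` essential_spectrum A) l'%:C.
  split=> //; exists l' => //=; rewrite in_itv /=; apply/andP; split; lra.
by rewrite gap.
Qed.

Variables (kappa : R) (kappa_ge0 : 0 <= kappa).
Hypothesis B_lower : forall x, (\bigcup_(t in `[0%R, 1%R])
  range (spectral_projection dot (At t) b)) x -> kappa%:C * `|x| ^+ 2 <= dot x (B x).

(* Measured from the centre [l + d / 4], approximate eigenvectors of [At t] at
   [l] have, under [At (t + h)], distance
   [|h B x - (d / 4) x| <= (d / 4 - h kappa + C h^2) |x|]. *)
Lemma essential_step t h l (d := b - a - beta) (C := beta ^+ 2 / (d / 4)) :
  0 <= t -> t + h <= 1 -> 0 < h -> h * kappa <= d / 8 ->
  (C + 1) * h ^+ 2 < d / 2 ->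
  l < b -> essential_spectrum (At t) l%:C ->
  exists l', [/\ l + h * kappa - (C + 1) * h ^+ 2 <= l', l' < b &
    essential_spectrum (At (t + h)) l'%:C].
Proof.
move=> t0 th h0 hk hC lb ess.
have b0 := operator_norm_ge0.
(* The distance [d] to [b] serves for every [t] in [0, 1], which makes the constants of the step
   uniform. *)
have ld : l <= b - d.
  have := essential_upper t0 lb ess; rewrite /d.
  have : t * beta <= 1 * beta by rewrite ler_wpM2r//; lra.
  lra.
have d0 : 0 < d by rewrite subr_gt0.
have C0 : 0 <= C by rewrite mulr_ge0 ?sqr_ge0// invr_ge0 divr_ge0// ltW.
have CE : C * (d / 4) = beta ^+ 2 by rewrite divfK// gt_eqF// divr_gt0.
clearbody C; clearbody d.
have h20 : 0 < h ^+ 2 by rewrite exprn_gt0.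
have hh : h ^+ 2 <= (C + 1) * h ^+ 2 by rewrite ler_peMl ?(ltW h20)//; lra.
have lhb : l + h ^+ 2 <= b by lra.
have [V [sV infV hV]] := weyl_subspace dot_norm (At_self_adjoint t) ess h20 lhb.
(* The term [C h^2] pays for [h^2 |B x|^2]: as [h kappa <= d / 8], squaring [q] produces [2 C h^2 (d
   / 4 - h kappa) >= C h^2 d / 4 = beta^2 h^2]. *)
pose q := d / 4 - h * kappa + C * h ^+ 2.
have hk0 : 0 <= h * kappa by rewrite mulr_ge0// ltW.
have Ch0 : 0 <= C * h ^+ 2 by rewrite mulr_ge0// ltW.
have q0 : 0 <= q by rewrite /q; lra.
have r0 : 0 <= h ^+ 2 + q by rewrite addr_ge0// ltW.
have [|l' [l1 l2 essl']] := essential_of_subspace dot_norm (At_self_adjoint (t + h))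
    sV infV (m := l + d / 4) r0.
  move=> x /hV[Ax hx rx]; split=> //.
  have low : kappa * nm x ^+ 2 <= ip x (B x).
    have : kappa%:C * `|x| ^+ 2 <= dot x (B x).
      apply: B_lower; exists t; last exact: rx.
      by rewrite /= in_itv /= t0 /=; lra.
    by rewrite normE -rmorphXn -rmorphM lecE /= => /andP[].
  have -> : At (t + h) x - (l + d / 4)%:C *: x =
      (At t x - l%:C *: x) + (h%:C *: B x - (d / 4)%:C *: x).
    move: (d / 4) => d4.
    have e2 (u v : R) y : (u + v)%:C *: y = u%:C *: y + v%:C *: y :> H.
      by rewrite rmorphD scalerDl.
    by rewrite /= !e2 opprD (addrA (A x)) addrACA.
  apply: le_trans (nmD _ _) _; rewrite mulrDl; apply: lerD => //.
  rewrite -ler_sqr ?nnegrE ?nm_ge0 ?mulr_ge0 ?nm_ge0//.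
  have -> : nm (h%:C *: B x - (d / 4)%:C *: x) ^+ 2 =
      h ^+ 2 * nm (B x) ^+ 2 - 2 * (d / 4) * (h * ip x (B x)) + (d / 4) ^+ 2 * nm x ^+ 2.
    by rewrite !(nm2 dot_norm) !ipE (ipC _ (B x) x); ring.
  have bx : nm (B x) ^+ 2 <= beta ^+ 2 * nm x ^+ 2.
    by rewrite -exprMn ler_sqr ?nnegrE ?nm_ge0 ?mulr_ge0 ?nm_ge0// bounded_nm.
  apply: (@le_trans _ _ ((h ^+ 2 * (C * (d / 4)) - 2 * (d / 4) * (h * kappa) + (d / 4) ^+ 2) * nm x ^+ 2)).
    rewrite CE.
    have : h ^+ 2 * nm (B x) ^+ 2 <= h ^+ 2 * (beta ^+ 2 * nm x ^+ 2).
      by rewrite ler_pM2l.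
    have : d / 4 * (h * (kappa * nm x ^+ 2)) <= d / 4 * (h * ip x (B x)).
      by rewrite ler_pM2l ?ler_pM2l//; lra.
    move=> *; lra.
  rewrite [leRHS]exprMn ler_wpM2r ?sqr_ge0//.
  have -> : q ^+ 2 = (d / 4) ^+ 2 - 2 * (d / 4) * (h * kappa) + (h * kappa) ^+ 2
    + 2 * (C * h ^+ 2) * (d / 4 - h * kappa) + (C * h ^+ 2) ^+ 2.
    by rewrite /q; ring.
  have := sqr_ge0 (h * kappa); have := sqr_ge0 (C * h ^+ 2).
  have : C * h ^+ 2 * (d / 8) <= C * h ^+ 2 * (d / 4 - h * kappa).
    by rewrite ler_wpM2l//; lra.
  move=> *; lra.
(* The lower end of the interval is exactly [l + h kappa - (C + 1) h^2]; the upper end is at most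
   [l + d / 2 + (C + 1) h^2 < l + d <= b]. *)
exists l'; split=> //.
  by apply: le_trans l1; rewrite /q; lra.
by apply: le_lt_trans l2 _; rewrite /q; lra.
Qed.

Hypotheses (ltab : a < b) (a_ess : essential_spectrum A a%:C).

(** Each of the [N + 1] steps gains [h kappa] and loses [(C + 1) h^2]; since [(N + 1) h = 1], the
    total loss is [(C + 1) h]. *)
Lemma essential_iterate (d := b - a - beta) (C := beta ^+ 2 / (d / 4)) N
    (h : R := N.+1%:R^-1) : h * kappa <= d / 8 -> (C + 1) * h ^+ 2 < d / 2 ->
  exists l, [/\ a + kappa - (C + 1) * h <= l, l < b &
    essential_spectrum (op_add A B) l%:C].
Proof.
move=> hk hC.
have h0 : 0 < h by rewrite invr_gt0.
have Nh : N.+1%:R * h = 1 by rewrite mulfV.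
have ABsa : self_adjoint dot (op_add A B) by exact: self_adjoint_add.
have iter k : (k <= N.+1)%N -> exists l,
    [/\ a + k%:R * (h * kappa - (C + 1) * h ^+ 2) <= l, l < b &
      essential_spectrum (At (k%:R * h)) l%:C].
  elim: k => [_|k ih kN].
    exists a; rewrite mul0r addr0; split=> //.
    rewrite mul0r; apply: (essential_eq dot_norm _ _ _ _ a_ess) => //.
      exact: At_self_adjoint.
    by move=> x /=; rewrite scale0r addr0.
  have [l [al lb ess]] := ih (ltnW kN).
  have kh0 : 0 <= k%:R * h by rewrite mulr_ge0// ltW.
  have kE : k.+1%:R * h = k%:R * h + h by rewrite -natr1 mulrDl mul1r.
  have kh1 : k%:R * h + h <= 1.
    by rewrite -kE -[leRHS]Nh; apply: ler_wpM2r; [exact: ltW|rewrite ler_nat].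
  have [l' [l1 l2 ess']] := essential_step kh0 kh1 h0 hk hC lb ess.
  exists l'; rewrite kE; split=> //; apply: le_trans l1.
  by rewrite -natr1 mulrDl mul1r addrA -[leRHS]addrA lerD2r.
have [l [al lb ess]] := iter N.+1 (leqnn _).
exists l; split=> //.
  apply: le_trans al; rewrite mulrBr mulrA Nh mul1r mulrCA expr2 (mulrA _ h h) Nh.
  by rewrite mul1r addrA.
apply: (essential_eq dot_norm _ _ _ _ ess) => //; first exact: At_self_adjoint.
by move=> x /=; rewrite Nh scale1r.
Qed.

End Perturbation.

Theorem theorem3p12 (R : realType) (H : completeNormedModType R[i])
    (dot : {dot H for Num.conj}) (dot_norm : induces_norm dot)
    (H_infinite : ~ finite_dimensional [set: H])
    (A : operator H) (A_self_adjoint : self_adjoint dot A)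
    (a b : R) (ltab : a < b)
    (gap : [set l%:C | l in `]a, b[] `&` essential_spectrum A = set0)
    (a_ess : essential_spectrum A a%:C)
    (kappa : R) (kappa_ge0 : 0 <= kappa)
    (B : {linear H -> H}) (B_bounded : bounded_operator B)
    (B_symmetric : symmetric_operator dot B)
    (B_ge0 : nonnegative_operator dot B)
    (B_small : operator_norm B < b - a)
    (B_lower : forall x,
       (\bigcup_(t in `[0%R, 1%R])
          range (spectral_projection dot (op_add A (t%:C \*: B)) b)) x ->
       kappa%:C * `|x| ^+ 2 <= dot x (B x)) :
  [set l%:C | l in `[a + kappa, b[] `&` essential_spectrum (op_add A B) !=set0.
Proof.
have ABsa : self_adjoint dot (op_add A B) by exact: self_adjoint_add.
have b0 := operator_norm_ge0 B_bounded.
pose d := b - a - operator_norm B.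
pose C := operator_norm B ^+ 2 / (d / 4).
have d0 : 0 < d by rewrite subr_gt0.
have C0 : 0 <= C by rewrite mulr_ge0 ?sqr_ge0// invr_ge0 divr_ge0// ltW.
have iter N (h : R := N.+1%:R^-1) : h * kappa <= d / 8 -> (C + 1) * h ^+ 2 < d / 2 ->
    exists l, [/\ a + kappa - (C + 1) * h <= l, l < b &
      essential_spectrum (op_add A B) l%:C].
  exact: essential_iterate.
(* This keeps the supremum taken at the end strictly below [b]. *)
have upper l : l < b -> essential_spectrum (op_add A B) l%:C ->
    l <= a + operator_norm B.
  move=> lb ess; rewrite -[operator_norm B]mul1r.
  apply: (essential_upper dot_norm A_self_adjoint B_bounded B_symmetric B_ge0 gap ler01 lb).
  apply: (essential_eq dot_norm ABsa _ _ _ ess) => //.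
    exact: At_self_adjoint.
  by move=> x /=; rewrite scale1r.
have approx e : 0 < e -> exists l, [/\ a + kappa - e <= l, l < b &
    essential_spectrum (op_add A B) l%:C].
  move=> e0.
  (* The first bound gives [h kappa <= d / 8]. The second gives [(C + 1) h < d / 4], enough for the
     quadratic condition as [h <= 1], and a loss below [e]. *)
  pose m := Num.min (d / 8 / (kappa + 1)) (Num.min (d / 4) e / (C + 1)).
  have k1 : 0 < kappa + 1 by rewrite ltr_wpDl.
  have C1 : 0 < C + 1 by rewrite ltr_wpDl.
  have m0 : 0 < m.
    rewrite lt_min (divr_gt0 _ k1) ?divr_gt0//=.
    by rewrite lt_min e0 divr_gt0.
  have [N _ /(_ N (leqnn N)) /=] := (cvgrPdist_lt _ _).1 (@cvg_harmonic R) _ m0.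
  rewrite sub0r normrN ger0_norm ?invr_ge0// lt_min !ltr_pdivlMr//.
  have h0 : 0 < N.+1%:R^-1 :> R by rewrite invr_gt0.
  have h1 : N.+1%:R^-1 <= 1 :> R by rewrite invf_le1// ler1n.
  move: (iter N) => /=; move: (N.+1%:R^-1 : R) h0 h1 => h h0 h1 it.
  rewrite lt_min => /andP[hk /andP[hd he]].
  have [||l [l1 l2 l3]] := it.
  - by nra.
  - have : (C + 1) * h ^+ 2 <= h * (C + 1).
      by rewrite expr2 [leRHS]mulrC ler_pM2l// ger_pMl//.
    lra.
  exists l; split=> //; lra.
(* The point found by [approx] varies with [e]; the supremum of all essential points below [b]
   exceeds every [a + kappa - e] at once and is itself essential by closedness. *)
pose S := [set l | l < b /\ essential_spectrum (op_add A B) l%:C].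
have [l0 [_ l0b l0e]] := approx 1 ltr01.
have hS : has_sup S.
  by split; [exists l0|exists (a + operator_norm B) => l [lb le]; exact: upper].
have Tub : sup S <= a + operator_norm B.
  by apply: ge_sup; [exists l0|move=> l [lb le]; exact: upper].
exists (sup S)%:C; split.
  exists (sup S) => //=; rewrite in_itv /=; apply/andP; split; last by lra.
  apply/ler_addgt0Pr => e e0; have [l [l1 l2 l3]] := approx e e0.
  have := sup_upper_bound hS; move=> /(_ l (conj l2 l3)); lra.
apply: (essential_closed dot_norm ABsa) => e e0.
have [l Sl lT] := sup_adherent e0 hS; exists l; first by case: Sl.
have lS := sup_upper_bound hS Sl.
by rewrite ltr_norml; apply/andP; split; lra.
Qed.
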